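(* Let $(A+\gamma I),(B+\mu I)\in\mathscr{PC}_2(\mathcal{H})$. Let $\beta>0$ be fixed. Assume that $r=r(\alpha)$ is a smooth real-valued function of $\alpha$, with value $r(0)=r(\alpha=0)$ at $\alpha=0$, and with $r(\alpha)\neq0$ for $\alpha>0$ (so that the divergence below is defined). Then (the limit being taken through $\alpha>0$) $$\lim_{\alpha\to0}D_{r}^{(\alpha,\beta)}[(A+\gamma I),(B+\mu I)]=\frac{1}{\beta^2}\left[\left(\frac{\gamma}{\mu}\right)^{r(0)}-1\right]\left(1+r(0)\log\frac{\gamma}{\mu}\right)-\frac{1}{\beta^2}\left(\frac{\gamma}{\mu}\right)^{r(0)}\log\det{}_{2X}\left([(B+\mu I)^{-1}(A+\gamma I)]^{r(0)}\right),$$ where on the left-hand side $r=r(\alpha)$.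
   Context: $\mathcal{H}$ is a real separable Hilbert space with $\dim\mathcal{H}=\infty$, $I$ its identity operator; $\mathcal{L}(\mathcal{H})$, $\mathrm{Tr}(\mathcal{H})$, $\mathrm{HS}(\mathcal{H})$ are the bounded, trace class and Hilbert-Schmidt operators. $\mathrm{Tr}_X(\mathcal{H})=\{A+\gamma I:A\in\mathrm{Tr}(\mathcal{H}),\gamma\in\mathbb{R}\}$, $\mathrm{HS}_X(\mathcal{H})=\{A+\gamma I:A\in\mathrm{HS}(\mathcal{H}),\gamma\in\mathbb{R}\}$. An operator $T$ is positive definite, $T>0$, if $T=T^*$ and there is $M>0$ with $\langle x,Tx\rangle\ge M\|x\|^2$ for all $x$. $\mathscr{PC}_2(\mathcal{H})=\{A+\gamma I>0:A=A^*,A\in\mathrm{HS}(\mathcal{H}),\gamma\in\mathbb{R}\}$ (necessarily $\gamma>0$). For $P\in\mathscr{PC}_2(\mathcal{H})$, $\log P$ is defined by the spectral calculus and $P^s=\exp(s\log P)$, $s\in\mathbb{R}$. If $T=CPC^{-1}$ with $P\in\mathscr{PC}_2(\mathcal{H})$ and $C\in\mathcal{L}(\mathcal{H})$ invertible, then $T^s=CP^sC^{-1}\in\mathrm{HS}_X(\mathcal{H})$; this applies to $(B+\mu I)^{-1}(A+\gamma I)=(B+\mu I)^{-1/2}[(B+\mu I)^{-1/2}(A+\gamma I)(B+\mu I)^{-1/2}](B+\mu I)^{1/2}$. Extended Fredholm determinant: for $A+\gamma I\in\mathrm{Tr}_X(\mathcal{H})$, $\gamma\ne0$, $\det_X(A+\gamma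 I)=\gamma\det(A/\gamma+I)$, with $\det$ the Fredholm determinant. Extended Hilbert-Carleman determinant: for $A+\gamma I\in\mathrm{HS}_X(\mathcal{H})$, $\gamma\ne0$, $\det_{2X}(A+\gamma I)=\det_X[(A+\gamma I)\exp(-A/\gamma)]$ (the operator in brackets is in $\mathrm{Tr}_X(\mathcal{H})$). For $\alpha>0$, $\beta>0$, $r\in\mathbb{R}$ with $r\neq0$, and $(A+\gamma I),(B+\mu I)\in\mathscr{PC}_2(\mathcal{H})$, the Alpha-Beta Log-Determinant divergence is $$D_r^{(\alpha,\beta)}[(A+\gamma I),(B+\mu I)]=\frac{1}{\alpha\beta}\log\left[\left(\frac{\gamma}{\mu}\right)^{r(\delta-\frac{\alpha}{\alpha+\beta})}\det{}_X\left(\frac{\alpha(\Lambda+\frac{\gamma}{\mu}I)^{r(1-\delta)}+\beta(\Lambda+\frac{\gamma}{\mu}I)^{-r\delta}}{\alpha+\beta}\right)\right],$$ where $\Lambda+\frac{\gamma}{\mu}I=(B+\mu I)^{-1/2}(A+\gamma I)(B+\mu I)^{-1/2}$ and $\delta=\frac{\alpha\gamma^r}{\alpha\gamma^r+\beta\mu^r}$ (the operator inside $\det_X$ belongs to $\mathrm{Tr}_X(\mathcal{H})$). *)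

(* Defs.v *)
From HB Require Import structures.
From mathcomp Require Import all_boot all_order all_algebra.
From mathcomp Require Import sesquilinear.
From mathcomp Require Import all_classical all_reals all_analysis.

Set Implicit Arguments.
Unset Strict Implicit.
Unset Printing Implicit Defensive.

Import Order.TTheory GRing.Theory Num.Theory.
Import numFieldNormedType.Exports.

Local Open Scope classical_set_scope.
Local Open Scope ring_scope.

(* A Hilbert space is a complete normed module [H] together with an inner
   product [ip : {dot H for idfun}] such that [`|x| ^+ 2 = ip x x]. This last
   identity, separability and infinite dimension are hypotheses of the theorem;
   they are not built into the definitions below. *)

Definition separable (T : topologicalType) : Prop :=
  exists2 S : set T, countable S & dense S.

Definition finite_dim (R : realType) (H : lmodType R) : Prop :=
  exists (n : nat) (b : 'I_n -> H),
    forall x, exists c : 'I_n -> R, x = \sum_(i < n) c i *: b i.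

(* Smoothness on an arbitrary set: existence of a smooth extension. *)
Definition smooth_on (R : realType) (D : set R) (f : R -> R) : Prop :=
  exists2 g : R -> R,
    (forall (n : nat) (x : R), derivable (derive1n n g) x 1) &
    (forall x, D x -> f x = g x).

Section Operators.
Variables (R : realType) (H : completeNormedModType R) (ip : {dot H for idfun}).

Implicit Types (A B C K P Q S T : H -> H) (e : nat -> H) (s gam mu : R).

Definition bounded_op T : Prop := linear T /\ continuous T.

(* [A + gam I] *)
Definition plusI A gam : H -> H := fun x => A x + gam *: x.

Definition selfadjoint T : Prop :=
  bounded_op T /\ forall x y, ip (T x) y = ip x (T y).

Definition posdef T : Prop :=
  selfadjoint T /\ exists2 M : R, 0 < M & forall x, M * `|x| ^+ 2 <= ip x (T x).

Definition onb e : Prop :=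
  (forall i j, ip (e i) (e j) = (i == j)%:R) /\
  (forall x, (forall i, ip x (e i) = 0) -> x = 0).

(* The sums in [hilbert_schmidt] and [trace_class] have nonnegative terms and
   do not depend on the orthonormal basis. *)
Definition hilbert_schmidt A : Prop :=
  bounded_op A /\
  exists e, onb e /\ cvgn (series (fun k => `|A (e k)| ^+ 2)).

(* [S] is the absolute value |A|: the nonnegative square root of A^* A. *)
Definition is_absop A S : Prop :=
  [/\ selfadjoint S, (forall x, 0 <= ip x (S x)) &
      (forall x y, ip x (S (S y)) = ip (A x) (A y))].

Definition trace_class A : Prop :=
  bounded_op A /\
  exists S e, [/\ is_absop A S, onb e &
                  cvgn (series (fun k => ip (e k) (S (e k))))].

(* The decomposition [A + gam I] of an element of [PC2] is unique because [H]
   is infinite dimensional; the predicate bears on the pair. *)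
Definition PC2 A gam : Prop :=
  [/\ hilbert_schmidt A, selfadjoint A & posdef (plusI A gam)].

(* Spectral calculus for operators having an orthonormal basis of
   eigenvectors (every [A + gam I] with [A] compact and self-adjoint):
   f (sum_k lam_k e_k (x) e_k) = sum_k f(lam_k) e_k (x) e_k. *)
Definition spectral_fun (f : R -> R) T : H -> H :=
  get [set Q | bounded_op Q /\
    exists e (lam : nat -> R), onb e /\
      forall k, T (e k) = lam k *: e k /\ Q (e k) = f (lam k) *: e k].

Definition op_log P : H -> H := spectral_fun (@ln R) P.

Definition op_exp T : H -> H :=
  fun x => limn (series (fun k => (k`!%:R)^-1 *: iter k T x)).

Definition op_inv T : H -> H := fun y => get [set x | T x = y].

(* P^s = exp (s log P), for positive definite [P] *)
Definition op_pow P s : H -> H := op_exp (fun x => s *: op_log P x).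

(* T^s = C P^s C^-1 for T = C P C^-1 with P in PC2; the result does not depend
   on the choice of [C] and [P]. *)
Definition sim_pow T s : H -> H :=
  get [set Q | exists C C' A gam,
    [/\ bounded_op C /\ bounded_op C', cancel C C' /\ cancel C' C, PC2 A gam,
        T = C \o plusI A gam \o C' &
        Q = C \o op_pow (plusI A gam) s \o C']].

Definition basis : nat -> H := get onb.

(* The trace of the k-th exterior power of [K]:
   sum over i_1 < ... < i_k of det (<e_(i_a), K e_(i_b)>)_(a, b). Summing over
   all k-tuples counts each subset k! times, and tuples with a repeated index
   contribute 0. *)
Definition ext_trace K (k : nat) : R :=
  limn (fun N : nat => (k`!%:R)^-1 *
    \sum_(i : {ffun 'I_k -> 'I_N})
      \det (\matrix_(a < k, b < k) ip (basis (i a)) (K (basis (i b))))).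

(* Fredholm determinant det (I + K), for [K] of trace class; it does not depend
   on the basis. *)
Definition fredholm_det K : R := limn (series (ext_trace K)).

(* The scalar [gam] such that [T = A + gam I] with [A] in the ideal [J]. *)
Definition scalar_part (J : (H -> H) -> Prop) T : R :=
  get [set gam | J (plusI T (- gam))].

Definition detX T : R :=
  let gam := scalar_part trace_class T in
  gam * fredholm_det (fun x => gam^-1 *: plusI T (- gam) x).

Definition det2X T : R :=
  let gam := scalar_part hilbert_schmidt T in
  let A := plusI T (- gam) in
  detX (T \o op_exp (fun x => - (gam^-1 *: A x))).

(* (B + mu I)^(-1/2) (A + gam I) (B + mu I)^(-1/2) *)
Definition rel_op A gam B mu : H -> H :=
  let C := op_pow (plusI B mu) (- 2^-1) in C \o plusI A gam \o C.

Definition logdet_div (alpha beta r : R) A gam B mu : R :=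
  let delta := alpha * gam `^ r / (alpha * gam `^ r + beta * mu `^ r) in
  let L := rel_op A gam B mu in
  (alpha * beta)^-1 *
  ln ((gam / mu) `^ (r * (delta - alpha / (alpha + beta))) *
      detX (fun x => (alpha + beta)^-1 *:
              (alpha *: op_pow L (r * (1 - delta)) x +
               beta *: op_pow L (- (r * delta)) x))).

End Operators.

(* Main.v *)
Require Import Defs.
From HB Require Import structures.
From mathcomp Require Import all_boot all_order all_algebra.
From mathcomp Require Import sesquilinear.
From mathcomp Require Import all_classical all_reals all_analysis.
From mathcomp Require Import fingroup perm ring lra.

Set Implicit Arguments.
Unset Strict Implicit.
Unset Printing Implicit Defensive.

Import Order.TTheory GRing.Theory Num.Theory.
Import numFieldNormedType.Exports.

Local Open Scope classical_set_scope.
Local Open Scope ring_scope.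

(** Write nu = gam / mu and let nu * exp (t_j), with (t_j) square summable, be
    the eigenvalues of Lambda + nu I. The weight delta is chosen so that the
    eigenvalues of the operator inside det_X, divided by their scalar part, are
    delta * exp (r (1 - delta) t_j) + (1 - delta) * exp (- r delta t_j) =
    exp (w_j) with 0 <= w_j <= delta * (exp (r t_j) - 1 - r t_j). Since
    delta / alpha tends to nu^(r 0) / beta, dominated convergence gives
    sum_j w_j / alpha --> nu^(r 0) / beta * sum_j (exp (r0 t_j) - 1 - r0 t_j)
    with r0 = r 0, and the last sum is minus the logarithm of det_2X divided by
    the scalar part.

    What makes this rigorous for the determinants, which are defined by minors in
    an arbitrary orthonormal basis, is that an operator C D C^-1 with D diagonal
    with summable entries d_j has Fredholm determinant prod_j (1 + d_j): the
    identity tr Lambda^k (X Y) = tr Lambda^k (Y X) moves the minors to the basis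
    of eigenvectors. The eigenvectors come from the spectral theorem for
    self-adjoint Hilbert-Schmidt operators, by maximality of an orthonormal set
    of eigenvectors. *)

(** * Series *)

(** The t_j are only square summable, so neither power inside det_X need be a scalar plus a trace
    class operator. In delta * exp (r (1 - delta) t_j) + (1 - delta) * exp (- r delta t_j) the terms
    linear in t_j cancel, which leaves w_j of order t_j^2; the factor exp (- A / gamma) achieves the
    same cancellation in det_2X. Two obstacles shape the rest. The operator (B + mu I)^-1 (A + gamma
    I) is similar to a self-adjoint one but need not be self-adjoint, so its eigenvectors need not
    be orthogonal and determinants are required for conjugates C D C^-1. Moreover powers, scalar
    parts and the basis of the determinant are picked by [get], and each value must be shown
    independent of the choice: by following eigenvectors for powers, because no nonzero multiple of
    I is Hilbert-Schmidt for scalar parts, by an exchange of limits for the basis. *)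

Lemma eq_cvgn (V : nbhsType) (u v : nat -> V) (l : V) :
  (forall n, u n = v n) -> (u @ \oo --> l) -> (v @ \oo --> l).
Proof. by move=> /funext ->. Qed.
Arguments eq_cvgn {V u v l}.

Lemma cvgn_unique (K : numFieldType) (V : normedModType K) (u : nat -> V) (l l' : V) :
  (u @ \oo --> l) -> (u @ \oo --> l') -> l = l'.
Proof. by move=> ul ul'; rewrite -(cvg_lim _ ul)// -(cvg_lim _ ul'). Qed.
Arguments cvgn_unique {K V u l l'}.

Lemma cvg_bigsum (K : numFieldType) (V : normedModType K) (T I : Type)
    (F : set_system T) (r : seq I) (f : I -> T -> V) (l : I -> V) : Filter F ->
  (forall i, f i x @[x --> F] --> l i) ->
  \sum_(i <- r) f i x @[x --> F] --> \sum_(i <- r) l i.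
Proof.
by move=> FF fl; apply: cvg_big => //; exact: add_continuous.
Qed.

Lemma cvg_bigprod (K : numFieldType) (T I : Type)
    (F : set_system T) (r : seq I) (f : I -> T -> K) (l : I -> K) : Filter F ->
  (forall i, f i x @[x --> F] --> l i) ->
  \prod_(i <- r) f i x @[x --> F] --> \prod_(i <- r) l i.
Proof.
by move=> FF fl; apply: cvg_big => //; exact: mul_continuous.
Qed.

Section Series.
Variable R : realType.
Implicit Types (a b : nat -> R).

Lemma seriesE (V : zmodType) (u : nat -> V) n : series u n = \sum_(k < n) u k.
Proof. by rewrite seriesEord. Qed.

Lemma nneg_series_is_cvg a X :
  (forall k, 0 <= a k) -> (forall n, series a n <= X) -> cvgn (series a).
Proof.
move=> a0 aX; apply: nondecreasing_is_cvgn; first exact: nondecreasing_series.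
by exists X => _ [n _ <-].
Qed.

Lemma nneg_series_le_lim a n :
  (forall k, 0 <= a k) -> cvgn (series a) -> series a n <= limn (series a).
Proof.
move=> a0 ca; apply: nondecreasing_cvgn_le => //.
exact: nondecreasing_series.
Qed.

Lemma le_norm_series_is_cvg a b :
  (forall k, `|a k| <= b k) -> cvgn (series b) -> cvgn (series a).
Proof.
move=> ab cb; apply: normed_cvg; apply: series_le_cvg cb => //= k.
by apply: le_trans (ab k).
Qed.

Lemma series_tail_le a b N : (forall k, `|a k| <= b k) -> cvgn (series b) ->
  `|limn (series a) - series a N| <= limn (series b) - series b N.
Proof.
move=> ab cb; have ca := le_norm_series_is_cvg ab cb.
have c1 : `|series a n - series a N| @[n --> \oo] --> `|limn (series a) - series a N|.
  by apply: cvg_norm; apply: cvgB => //; exact: cvg_cst.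
have c2 : series b n - series b N @[n --> \oo] --> limn (series b) - series b N.
  by apply: cvgB => //; exact: cvg_cst.
rewrite -(cvg_lim _ c1)// -(cvg_lim _ c2)//.
apply: ler_lim; [exact: cvgP c1|exact: cvgP c2|].
near=> n; have Nn : (N <= n)%N by near: n; exact: nbhs_infty_ge.
rewrite !sub_series_geq//; apply: le_trans (ler_norm_sum _ _ _) _.
exact: ler_sum.
Unshelve. all: by end_near. Qed.

(** Tannery's theorem: the majorant makes the tails beyond [N] small uniformly in [x], and a finite
    sum remains. The filter is arbitrary because the limit is taken both at infinity, in the number
    of eigenvalues, and at [0^'+], in alpha. *)
Lemma cvg_series_dominated (T : Type) (F : set_system T) (a : T -> nat -> R)
    (b l : nat -> R) : ProperFilter F -> cvgn (series b) ->
  (\forall x \near F, forall k, `|a x k| <= b k) ->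
  (forall k, a x k @[x --> F] --> l k) ->
  limn (series (a x)) @[x --> F] --> limn (series l).
Proof.
move=> FF cb ab al.
have lb k : `|l k| <= b k.
  have c : `|a x k| @[x --> F] --> `|l k| by exact: cvg_norm.
  rewrite -(cvg_lim _ c)//.
  apply: limr_le; first exact: cvgP c.
  by near=> x; near: x; apply: filterS ab => x; exact.
apply/cvgrPdist_lt => e e0.
have e3 : 0 < e / 3 by rewrite divr_gt0.
have [N HN] : exists N, limn (series b) - series b N < e / 3.
  have /cvgrPdist_lt/(_ _ e3) H := cb; near \oo => N; exists N.
  by apply: le_lt_trans (ler_norm _) _; near: N.
have cN : series (a x) N @[x --> F] --> series l N.
  by rewrite /series/=; exact: cvg_bigsum.
move/cvgrPdist_lt : cN => /(_ _ e3) cN.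
near=> x.
have h1 := series_tail_le N lb cb.
have h2 : `|limn (series (a x)) - series (a x) N| <= limn (series b) - series b N.
  by apply: series_tail_le => //; near: x.
have h3 : `|series l N - series (a x) N| < e / 3 by near: x.
move: h1 h2 h3 HN; rewrite !ler_norml !ltr_norml.
move=> /andP[? ?] /andP[? ?] /andP[? ?] ?; apply/andP; split; lra.
Unshelve. all: by end_near. Qed.

Lemma cvg_prod_expR (w : nat -> R) : cvgn (series w) ->
  \prod_(j < n) expR (w j) @[n --> \oo] --> expR (limn (series w)).
Proof.
move=> cw; have -> : (fun n => \prod_(j < n) expR (w j)) = expR \o series w.
  by apply/funext => n /=; rewrite seriesEord expR_sum.
by apply: continuous_cvg => //; exact: continuous_expR.
Qed.

End Series.

(** * Sums of principal minors *)

Section Minors.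
Variable R : realType.
Implicit Types (X Y W G : nat -> nat -> R) (d : nat -> R).

(** The trace of Lambda^k of the N x N corner of [G], in the form used by [ext_trace]. Indexing [G]
    by [nat] lets [N] vary. *)
Definition minor_sum (N k : nat) G : R :=
  (k`!%:R)^-1 * \sum_(i : {ffun 'I_k -> 'I_N})
    \det (\matrix_(a < k, b < k) G (i a) (i b)).

(* tr Lambda^k (X Y) = tr Lambda^k (Y X) *)
Lemma minor_sum_mulC N M k X Y :
  minor_sum N k (fun i i' => \sum_(j < M) X i j * Y j i') =
  minor_sum M k (fun j j' => \sum_(i < N) Y j i * X i j').
Proof.
rewrite /minor_sum; congr (_ * _).
(* Leibniz expansion of both sides over all pairs of tuples; allowing unordered tuples with
   repetitions avoids the increasing indices of Cauchy-Binet. *)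
transitivity (\sum_(s : 'S_k) \sum_(J : {ffun 'I_k -> 'I_M})
    \sum_(I : {ffun 'I_k -> 'I_N})
    (-1) ^+ s * \prod_a (X (I a) (J a) * Y (J a) (I (s a)))).
  under eq_bigr => I _.
    rewrite /determinant; under eq_bigr => s _.
      rewrite (eq_bigr (fun a => \sum_(j < M) X (I a) j * Y j (I (s a)))); last first.
        by move=> a _; rewrite mxE.
      rewrite (bigA_distr_bigA (fun a (j : 'I_M) => X (I a) j * Y j (I (s a)))) mulr_sumr.
    over.
  over.
  rewrite exchange_big/=; apply: eq_bigr => s _.
  by rewrite exchange_big.
under [RHS]eq_bigr => J _.
  rewrite /determinant; under eq_bigr => s _.
    rewrite (eq_bigr (fun a => \sum_(i < N) Y (J a) i * X i (J (s a)))); last first.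
      by move=> a _; rewrite mxE.
    rewrite (bigA_distr_bigA (fun a (i : 'I_N) => Y (J a) i * X i (J (s a)))) mulr_sumr.
  over.
over.
rewrite [RHS]exchange_big/=; apply: eq_bigr => s _; apply: eq_bigr => J _.
(* Relabelling [I] by the inverse of [s] frees [Y] from [s]; reindexing the product of the [X]
   factors by [s] then produces [J (s a)]. *)
pose h (I : {ffun 'I_k -> 'I_N}) := [ffun a => I ((s^-1)%g a)].
pose h' (I : {ffun 'I_k -> 'I_N}) := [ffun a => I (s a)].
have hK : cancel h h' by move=> I; apply/ffunP => a; rewrite !ffunE permK.
have Kh : cancel h' h by move=> I; apply/ffunP => a; rewrite !ffunE permKV.
rewrite (reindex h)/=; last by apply: onW_bij; exists h'.
apply: eq_bigr => I _; congr (_ * _).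
rewrite !big_split/= [RHS]mulrC; congr (_ * _); last first.
  by apply: eq_bigr => a _; rewrite ffunE permK.
rewrite (reindex_perm s)/=; apply: eq_bigr => a _.
by rewrite ffunE permK.
Qed.

Lemma minor_sum_cvg N k (T : Type) (F : set_system T) (G : T -> nat -> nat -> R) G' :
  Filter F -> (forall i j, G x i j @[x --> F] --> G' i j) ->
  minor_sum N k (G x) @[x --> F] --> minor_sum N k G'.
Proof.
move=> FF GG'; apply: cvgM; first exact: cvg_cst.
apply: cvg_bigsum => i; apply: cvg_bigsum => s.
apply: cvgM; first exact: cvg_cst.
apply: cvg_bigprod => a; rewrite mxE.
by under eq_cvg do rewrite mxE; exact: GG'.
Qed.

Lemma minor_det_scale k M (J : {ffun 'I_k -> 'I_M}) d W :
  \det (\matrix_(a < k, b < k) (d (J a) * W (J a) (J b))) =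
  \prod_a d (J a) * \det (\matrix_(a < k, b < k) W (J a) (J b)).
Proof.
rewrite /determinant mulr_sumr; apply: eq_bigr => s _.
rewrite mulrCA; congr (_ * _); rewrite -big_split/=.
by apply: eq_bigr => a _; rewrite !mxE.
Qed.

(** The k! of this crude Leibniz bound is absorbed by the factor 1 / k! of [minor_sum]. *)
Lemma norm_minor_det_le k M (J : {ffun 'I_k -> 'I_M}) W c :
  (forall j l, `|W j l| <= c) ->
  `|\det (\matrix_(a < k, b < k) W (J a) (J b))| <= k`!%:R * c ^+ k.
Proof.
move=> Wc; rewrite /determinant; apply: le_trans (ler_norm_sum _ _ _) _.
have H (s : 'S_k) : `|(-1) ^+ s * \prod_a (\matrix_(a < k, b < k) W (J a) (J b)) a (s a)|
    <= c ^+ k.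
  have -> : c ^+ k = \prod_(a < k) c by rewrite prodr_const card_ord.
  rewrite normrM normr_sign mul1r normr_prod.
  by apply: ler_prod => a _; rewrite mxE normr_ge0/=.
apply: le_trans (ler_sum _ (fun s _ => H s)) _.
by rewrite sumr_const card_Sn mulr_natl.
Qed.

Definition trunc (M : nat) d : nat -> R := fun j => if (j < M)%N then d j else 0.

Lemma sum_trunc M M' d : (M <= M')%N ->
  \sum_(j < M') trunc M d j = \sum_(j < M) d j.
Proof.
move=> MM'; rewrite (big_ord_widen _ (fun j => d j) MM') [RHS]big_mkcond.
exact: eq_bigr.
Qed.

(** A truncated product is either the whole product or 0. *)
Lemma norm_prod_trunc k M M' (J : {ffun 'I_k -> 'I_M'}) d :
  `|\prod_a d (J a) - \prod_a trunc M d (J a)| =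
  \prod_a `|d (J a)| - \prod_a `|trunc M d (J a)|.
Proof.
rewrite -!normr_prod; case: (boolP [forall a, J a < M]%N) => [/forallP JM|].
  rewrite [\prod_a trunc _ _ _](eq_bigr (fun a => d (J a))) ?subrr ?normr0//.
  by move=> a _; rewrite /trunc JM.
rewrite negb_forall => /existsP[a Ja].
suff -> : \prod_a trunc M d (J a) = 0 by rewrite normr0 !subr0.
by rewrite (bigD1 a)//= /trunc (negbTE Ja) mul0r.
Qed.

(** Only tuples with an index at least [M] contribute, and the products of the |d_j| over these
    tuples sum to a difference of k-th powers. *)
Lemma minor_sum_trunc_le M M' k d W c : (M <= M')%N ->
  (forall j l, `|W j l| <= c) ->
  `|minor_sum M' k (fun j l => d j * W j l) -
    minor_sum M' k (fun j l => trunc M d j * W j l)| <=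
  c ^+ k * ((\sum_(j < M') `|d j|) ^+ k - (\sum_(j < M) `|d j|) ^+ k).
Proof.
move=> MM' Wc; have kf : 0 < k`!%:R :> R by rewrite ltr0n fact_gt0.
have powS (f : nat -> R) :
    (\sum_(j < M') f j) ^+ k = \sum_(J : {ffun 'I_k -> 'I_M'}) \prod_a f (J a).
  by rewrite -(bigA_distr_bigA (fun=> fun j : 'I_M' => f j)) prodr_const card_ord.
have -> : \sum_(j < M) `|d j| = \sum_(j < M') `|trunc M d j|.
  rewrite -(sum_trunc (fun j => `|d j|) MM').
  by apply: eq_bigr => j _; rewrite /trunc; case: ifP; rewrite ?normr0.
rewrite (powS (fun j => `|d j|)) (powS (fun j => `|trunc M d j|)) -sumrB.
rewrite /minor_sum -mulrBr -sumrB normrM gtr0_norm ?invr_gt0//.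
rewrite ler_pdivrMl// mulrA mulr_sumr.
apply: le_trans (ler_norm_sum _ _ _) _; apply: ler_sum => J _.
rewrite !minor_det_scale -mulrBl normrM norm_prod_trunc mulrC.
apply: ler_wpM2r; last exact: norm_minor_det_le.
by rewrite -norm_prod_trunc.
Qed.

Definition delta (j l : nat) : R := (j == l)%:R.

Lemma det_delta k M (J : {ffun 'I_k -> 'I_M}) :
  \det (\matrix_(a < k, b < k) delta (J a) (J b)) = (injectiveb J)%:R.
Proof.
case: (boolP (injectiveb J)) => [/injectiveP Ji|/injectivePn [a [b ab Jab]]].
  rewrite -[RHS](det1 R k); congr (\det _); apply/matrixP => a b.
  by rewrite !mxE /delta (inj_eq val_inj) (inj_eq Ji).
by apply: (determinant_alternate ab) => x; rewrite !mxE Jab.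
Qed.

(** Tuples with a repeated index vanish and each k-subset is the image of k! injective tuples; what
    remains is the k-th elementary symmetric polynomial. *)
Lemma minor_sum_diag M k d :
  minor_sum M k (fun j l => d j * delta j l) =
  \sum_(A : {set 'I_M} | #|A| == k) \prod_(j in A) d j.
Proof.
rewrite /minor_sum.
under eq_bigr do rewrite minor_det_scale det_delta mulr_natr mulrb.
rewrite -big_mkcond/=.
rewrite (partition_big (fun J : {ffun 'I_k -> 'I_M} => J @: 'I_k)
  (fun A => #|A| == k))/=; last first.
  by move=> J /injectiveP Ji; rewrite card_imset// card_ord.
rewrite mulr_sumr; apply: eq_bigr => A /eqP Ak.
rewrite (eq_bigr (fun=> \prod_(j in A) d j)); last first.
  move=> J /andP[/injectiveP Ji /eqP <-].
  by rewrite big_imset//= => x y _ _; exact: Ji.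
rewrite sumr_const.
suff -> : #|[pred J : {ffun 'I_k -> 'I_M} | injectiveb J & J @: 'I_k == A]| = k`!.
  by rewrite -[X in _ * X]mulr_natl mulrA mulVf ?mul1r// pnatr_eq0 -lt0n fact_gt0.
have := card_inj_ffuns_on 'I_k (mem A); rewrite card_ord Ak ffactnn => <-.
rewrite -cardsE; apply: eq_card => J; rewrite !inE.
apply/andP/andP => -[].
  move=> Ji /eqP JA; split => //; apply/ffun_onP => a.
  by rewrite -JA; apply: imset_f.
move=> /ffun_onP JA Ji; split => //; rewrite eqEcard card_imset; last exact/injectiveP.
rewrite card_ord Ak leqnn andbT; apply/fintype.subsetP => _ /imsetP[a _ ->]; exact: JA.
Qed.

Lemma sum_minor_sum_diag M n d : (M < n)%N ->
  \sum_(k < n) minor_sum M k (fun j l => d j * delta j l) =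
  \prod_(j < M) (1 + d j).
Proof.
move=> Mn; under eq_bigr do rewrite minor_sum_diag.
under [RHS]eq_bigr do rewrite addrC.
(* The product is expanded over subsets, grouped by cardinality; [M < n] ensures that every
   cardinality occurs and that [inord] returns it unchanged. *)
rewrite bigA_distr/= [RHS](partition_big (fun A : {set 'I_M} => inord #|A| : 'I_n.-1.+1) predT)//=.
case: n Mn => // n Mn /=; apply: eq_bigr => k _.
apply: eq_big => [A|A _].
  rewrite -val_eqE/= inordK//; apply: leq_ltn_trans Mn.
  by rewrite -[X in (_ <= X)%N]card_ord max_card.
by rewrite big_mkcond/=.
Qed.

(** Terms of an exponential series: they supply the majorant for exchanging the sum over [k] with
    the limit in [M]. *)
Lemma minor_sum_diag_le M k d :
  `|minor_sum M k (fun j l => d j * delta j l)| <=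
  (\sum_(j < M) `|d j|) ^+ k / k`!%:R.
Proof.
rewrite /minor_sum normrM [X in X * _]ger0_norm ?invr_ge0 ?ler0n//.
rewrite mulrC; apply: ler_wpM2r; first by rewrite invr_ge0 ler0n.
have -> : (\sum_(j < M) `|d j|) ^+ k = \prod_(a < k) \sum_(j < M) `|d j|.
  by rewrite prodr_const card_ord.
rewrite (bigA_distr_bigA (fun=> fun j : 'I_M => `|d j|)).
apply: le_trans (ler_norm_sum _ _ _) _; apply: ler_sum => J _.
rewrite minor_det_scale det_delta normrM normr_prod ler_piMr//.
  by apply: prodr_ge0.
by case: injectiveb; rewrite ?normr1 ?normr0.
Qed.

End Minors.

(** * From minors in an arbitrary basis to an infinite product *)

Section MinorLimit.
Import ArrowAsUniformType.
Variables (R : realType) (X Y : nat -> nat -> R) (d : nat -> R) (c : R).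
Variable G : nat -> nat -> R.

(** [G] is X diag(d) Y, and [W] is the product in the other order, Y X, cut at [N]: by hypothesis it
    is bounded and tends entrywise to the identity. *)
Let W N j l := \sum_(i < N) Y j i * X i l.
Let S := limn (series (fun j => `|d j|)).

Hypothesis cvgW : forall j l, W N j l @[N --> \oo] --> delta R j l.
Hypothesis leW : forall N j l, `|W N j l| <= c.
Hypothesis cvgd : cvgn (series (fun j => `|d j|)).
Hypothesis cvgG : forall i i',
  \sum_(j < M) X i j * (d j * Y j i') @[M --> \oo] --> G i i'.

(** A double sequence: [M] cuts the spectral sum, [N] cuts the basis. The limit in [M] gives the
    minors of [G], the limit in [N] gives the symmetric polynomial [ek] of the first [M] entries. *)
Let F k M N := minor_sum N k (fun i i' => \sum_(j < M) X i j * (d j * Y j i')).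
Let ek k M := minor_sum M k (fun j l => d j * delta R j l).

Let FE k M N : F k M N = minor_sum M k (fun j l => d j * W N j l).
Proof.
rewrite /F (minor_sum_mulC _ _ _ X (fun j i => d j * Y j i)).
rewrite /minor_sum; congr (_ * _); apply: eq_bigr => J _; congr (\det _).
apply/matrixP => a b; rewrite !mxE /W mulr_sumr.
by apply: eq_bigr => i _; rewrite mulrA.
Qed.

Let FEtrunc k M M' N : (M <= M')%N ->
  F k M N = minor_sum M' k (fun j l => trunc M d j * W N j l).
Proof.
move=> MM'; transitivity (minor_sum N k
    (fun i i' => \sum_(j < M') X i j * (trunc M d j * Y j i'))).
  rewrite /F /minor_sum; congr (_ * _); apply: eq_bigr => I _; congr (\det _).
  apply/matrixP => a b; rewrite !mxE.
  rewrite -(sum_trunc (fun j => X (I a) j * (d j * Y j (I b))) MM').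
  apply: eq_bigr => j _; rewrite /trunc; case: ifP => // _.
  by rewrite mul0r mulr0.
rewrite (minor_sum_mulC _ _ _ X (fun j i => trunc M d j * Y j i)).
rewrite /minor_sum; congr (_ * _); apply: eq_bigr => J _; congr (\det _).
apply/matrixP => a b; rewrite !mxE /W mulr_sumr.
by apply: eq_bigr => i _; rewrite mulrA.
Qed.

Let c_ge0 : 0 <= c. Proof. by apply: le_trans (leW 0 0 0). Qed.

Let leS M : \sum_(j < M) `|d j| <= S.
Proof.
rewrite -(seriesE (fun j => `|d j|)).
exact: (@nneg_series_le_lim R (fun j => `|d j|) M (fun=> normr_ge0 _)).
Qed.

Let cvgFM k N : F k M N @[M --> \oo] --> minor_sum N k G.
Proof. exact: minor_sum_cvg. Qed.

Let cvgFN k M : F k M N @[N --> \oo] --> ek k M.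
Proof.
under eq_cvg do rewrite FE; apply: minor_sum_cvg => j l.
by apply: cvgM; [exact: cvg_cst|exact: cvgW].
Qed.

(** The bound is free of [N]: this uniformity permits the exchange of the two limits. *)
Let F_le k M N :
  `|minor_sum N k G - F k M N| <= c ^+ k * (S ^+ k - (\sum_(j < M) `|d j|) ^+ k).
Proof.
have c1 : `|F k M' N - F k M N| @[M' --> \oo] --> `|minor_sum N k G - F k M N|.
  by apply: cvg_norm; apply: cvgB; [exact: cvgFM|exact: cvg_cst].
rewrite -(cvg_lim _ c1)//; apply: limr_le; first exact: cvgP c1.
near=> M'; have MM' : (M <= M')%N by near: M'; exact: nbhs_infty_ge.
rewrite (FE k M') (FEtrunc _ _ MM').
apply: le_trans (minor_sum_trunc_le _ _ MM' _) _ => //.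
apply: ler_wpM2l; first exact: exprn_ge0.
by rewrite lerD2r lerXn2r// nnegrE ?(le_trans _ (leS 0)) ?big_ord0 ?sumr_ge0.
Unshelve. all: by end_near. Qed.

Lemma cvg_minor_sum k : exists E : R,
  ek k M @[M --> \oo] --> E /\ minor_sum N k G @[N --> \oo] --> E.
Proof.
(* Functions of [N] carry the uniform topology here, so the remaining goal is convergence in [M]
   uniformly in [N]. *)
apply: (@cvg_switch _ _ R \oo _ \oo _ (F k)) => //.
apply/cvg_ballP => e e0.
have : c ^+ k * (S ^+ k - (\sum_(j < M) `|d j|) ^+ k) @[M --> \oo] -->
    c ^+ k * (S ^+ k - S ^+ k).
  apply: cvgM; first exact: cvg_cst.
  apply: cvgB; first exact: cvg_cst.
  apply: (@continuous_cvg _ _ _ _ _ _ (fun x : R => x ^+ k)).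
    exact: exprn_continuous.
  by rewrite /S; move: cvgd; rewrite seriesEord.
rewrite subrr mulr0 => /cvgrPdist_lt/(_ _ e0) H.
near=> M => N; rewrite /ball/= /ball_.
apply: le_lt_trans (F_le k M N) _; near: M; apply: filterS H => M.
by rewrite sub0r normrN; exact/le_lt_trans/ler_norm.
Unshelve. all: by end_near. Qed.

(** For fixed [M] the series in [k] stops at [M] and equals the finite product; Tannery's theorem
    with majorant S^k / k! then lets [M] go to infinity under the sum. *)
Lemma lim_minor_series (P : R) :
  \prod_(j < M) (1 + d j) @[M --> \oo] --> P ->
  limn (series (fun k => limn (fun N => minor_sum N k G))) = P.
Proof.
move=> cP.
have E k : ek k M @[M --> \oo] --> limn (fun N => minor_sum N k G).
  by have [e [e1 e2]] := cvg_minor_sum k; rewrite (cvg_lim _ e2).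
have dom : limn (series (fun k => ek k M)) @[M --> \oo] -->
    limn (series (fun k => limn (fun N => minor_sum N k G))).
  apply: (@cvg_series_dominated _ _ _ (fun M k => ek k M) (exp_coeff S)).
  - exact: is_cvg_series_exp_coeff.
  - apply: nearW => M k; apply: le_trans (minor_sum_diag_le _ _ _) _.
    rewrite /exp_coeff/=; apply: ler_wpM2r; first by rewrite invr_ge0 ler0n.
    apply: lerXn2r; [by rewrite nnegrE sumr_ge0| |exact: leS].
    by rewrite nnegrE; apply: le_trans (leS 0); rewrite big_ord0.
  - exact: E.
apply/esym/(@cvg_unique _ _ (\prod_(j < M) (1 + d j) @[M --> \oo])) => //.
suff <- : (fun M => limn (series (fun k => ek k M))) =
    (fun M => \prod_(j < M) (1 + d j)) by exact: dom.
apply/funext => M; apply: cvg_lim => //; apply: cvg_near_cst.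
near=> n; rewrite seriesEord/=; apply: sum_minor_sum_diag.
by near: n; exact: nbhs_infty_gt.
Unshelve. all: by end_near. Qed.

End MinorLimit.

(** * Hilbert spaces and orthonormal bases *)

Lemma quadratic_ge0_discr (R : realFieldType) (a b c : R) : 0 <= c ->
  (forall t, 0 <= a + t * b *+ 2 + t ^+ 2 * c) -> b ^+ 2 <= a * c.
Proof.
move=> c_ge0 h; have [c0|c0] := eqVneq c 0.
  have [->|b0] := eqVneq b 0; first by rewrite c0 mulr0 expr0n.
  (* When [c = 0] the polynomial is affine, and its value at this point is -1. *)
  have := h (- (a + 1) / (b *+ 2)).
  rewrite c0 mulr0 addr0 -mulrnAr mulfVK; first lra.
  by rewrite mulrn_eq0 negb_or.
have cp : 0 < c by rewrite lt_def c0.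
have := h (- b / c).
have -> : a + - b / c * b *+ 2 + (- b / c) ^+ 2 * c = a - b ^+ 2 / c by field.
by rewrite subr_ge0 ler_pdivrMr.
Qed.

Section LinearProp.
Variables (R : pzRingType) (U V : lmodType R) (T : U -> V).
Hypothesis lT : linear T.

Lemma linear_propD x y : T (x + y) = T x + T y.
Proof. by have := lT 1 x y; rewrite !scale1r. Qed.

Lemma linear_prop0 : T 0 = 0.
Proof. by apply: (addrI (T 0)); rewrite -linear_propD !addr0. Qed.

Lemma linear_propZ a x : T (a *: x) = a *: T x.
Proof. by have := lT a x 0; rewrite !addr0 linear_prop0 addr0. Qed.

Lemma linear_propN x : T (- x) = - T x.
Proof. by rewrite -scaleN1r linear_propZ scaleN1r. Qed.

Lemma linear_propB x y : T (x - y) = T x - T y.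
Proof. by rewrite linear_propD linear_propN. Qed.

Lemma linear_prop_sum (I : Type) (r : seq I) (P : pred I) (F : I -> U) :
  T (\sum_(i <- r | P i) F i) = \sum_(i <- r | P i) T (F i).
Proof.
by apply: (big_morph T); [exact: linear_propD|exact: linear_prop0].
Qed.

End LinearProp.

Section Hilbert.
Variables (R : realType) (H : completeNormedModType R) (ip : {dot H for idfun}).
Hypothesis norm_ip : forall x : H, `|x| ^+ 2 = ip x x.
Implicit Types (x y z : H) (T S A C : H -> H) (e f : nat -> H).

Lemma ipC x y : ip x y = ip y x.
Proof. by rewrite (hermC ip) expr0 mul1r. Qed.

Lemma ip_linl y : linear (fun x => ip x y : R).
Proof. by move=> a u v; rewrite linearDl/= linearZl_LR. Qed.

Lemma ip_linr x : linear (fun y => ip x y : R).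
Proof. by move=> a u v; rewrite ipC ip_linl !(ipC x). Qed.

Definition ipDl x x' y := linear_propD (ip_linl y) x x'.
Definition ipBl x x' y := linear_propB (ip_linl y) x x'.
Definition ipZl a x y := linear_propZ (ip_linl y) a x : ip (a *: x) y = a * ip x y.
Definition ip_suml I r P F y := @linear_prop_sum _ _ _ _ (ip_linl y) I r P F.
Definition ipDr x y y' := linear_propD (ip_linr x) y y'.
Definition ipBr x y y' := linear_propB (ip_linr x) y y'.
Definition ipZr a x y := linear_propZ (ip_linr x) a y : ip x (a *: y) = a * ip x y.
Definition ip_sumr I r P F x := @linear_prop_sum _ _ _ _ (ip_linr x) I r P F.

(** The choice [S = id] gives the usual inequality; the choice of an absolute value |A| is what
    places trace class operators among the Hilbert-Schmidt ones. *)
Lemma psd_cauchy_schwarz S x y : linear S ->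
  (forall x y, ip (S x) y = ip x (S y)) -> (forall x, 0 <= ip x (S x)) ->
  ip x (S y) ^+ 2 <= ip x (S x) * ip y (S y).
Proof.
move=> lS sS S0; apply: quadratic_ge0_discr => // t.
have := S0 (x + t *: y).
rewrite (linear_propD lS) (linear_propZ lS) !ipDl !ipDr !ipZl !ipZr.
rewrite -(sS y x) (ipC (S y)) -/(ip x (S y)).
by congr (_ <= _); ring.
Qed.

Lemma cauchy_schwarz x y : `|ip x y| <= `|x| * `|y|.
Proof.
rewrite -ler_sqr ?nnegrE ?mulr_ge0// real_normK ?num_real// exprMn !norm_ip.
apply: (@psd_cauchy_schwarz idfun) => //.
by move=> z /=; rewrite -norm_ip sqr_ge0.
Qed.

Lemma cvg_ipl (T : Type) (F : set_system T) {FF : Filter F} (u : T -> H) x y :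
  u t @[t --> F] --> x -> ip (u t) y @[t --> F] --> ip x y.
Proof.
move=> ux; apply/cvgrPdist_le => e e0.
have y0 : 0 < `|y| + 1 by rewrite ltr_wpDl.
move/cvgrPdist_le : ux => /(_ _ (divr_gt0 e0 y0)); apply: filterS => t le_t.
rewrite -ipBl; apply: le_trans (cauchy_schwarz _ _) _.
have : `|x - u t| * `|y| <= e / (`|y| + 1) * (`|y| + 1).
  by apply: ler_pM => //; rewrite lerDl.
by rewrite mulfVK// gt_eqF.
Qed.

Lemma cvg_ipr (T : Type) (F : set_system T) {FF : Filter F} (u : T -> H) x y :
  u t @[t --> F] --> x -> ip y (u t) @[t --> F] --> ip y x.
Proof. by move=> ux; rewrite ipC; under eq_cvg do rewrite ipC; exact: cvg_ipl. Qed.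

Lemma norm_sum_ortho (r : seq nat) (c : nat -> R) (h : nat -> H) : uniq r ->
  (forall i j, i != j -> ip (h i) (h j) = 0) ->
  `|\sum_(k <- r) c k *: h k| ^+ 2 = \sum_(k <- r) c k ^+ 2 * ip (h k) (h k).
Proof.
move=> ur hh; rewrite norm_ip ip_suml; apply: eq_big_seq => k kr.
rewrite ip_sumr (bigD1_seq k)//= big1 ?addr0 => [|j jk]; first by rewrite ipZl ipZr mulrA.
by rewrite ipZl ipZr hh ?mulr0// eq_sym.
Qed.

(** Norms at most 1, not equal to 1, because the normalized families it is applied to may contain
    zero vectors. *)
Lemma bessel (h : nat -> H) x n : (forall i j, i != j -> ip (h i) (h j) = 0) ->
  (forall i, ip (h i) (h i) <= 1) -> \sum_(k < n) ip x (h k) ^+ 2 <= `|x| ^+ 2.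
Proof.
move=> hh h1; rewrite -(big_mkord xpredT (fun k => ip x (h k) ^+ 2)) /index_iota.
set r := iota _ _; have ur : uniq r by exact: iota_uniq.
set p := \sum_(k <- r) ip x (h k) *: h k.
have np : `|p| ^+ 2 <= \sum_(k <- r) ip x (h k) ^+ 2.
  rewrite norm_sum_ortho//; apply: ler_sum => k _.
  by rewrite ler_piMr// sqr_ge0.
have xp : ip x p = \sum_(k <- r) ip x (h k) ^+ 2.
  by rewrite ip_sumr; apply: eq_bigr => k _; rewrite ipZr.
have : 0 <= `|x - p| ^+ 2 by exact: sqr_ge0.
rewrite norm_ip ipBl !ipBr (ipC p x) -!norm_ip xp.
by move: np; lra.
Qed.

End Hilbert.

Arguments cvg_ipl {R H ip} norm_ip {T F FF u x} y _.
Arguments cvg_ipr {R H ip} norm_ip {T F FF u x} y _.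

(** * Orthonormal bases, bounded operators and adjoints *)

Section Onb.
Variables (R : realType) (H : completeNormedModType R) (ip : {dot H for idfun}).
Hypothesis norm_ip : forall x : H, `|x| ^+ 2 = ip x x.
Implicit Types (x y z : H) (T S A C : H -> H) (e f : nat -> H).

Lemma bounded_op_le T : bounded_op T ->
  exists2 M, 0 < M & forall x, `|T x| <= M * `|x|.
Proof.
move=> [lT cT].
pose f : {linear H -> H} := HB.pack T (GRing.isLinear.Build R H H *:%R T lT).
have /linear_boundedP : bounded_near f (nbhs 0) by apply/linear_bounded_continuous.
by move=> /pinfty_ex_gt0[M M0 fM]; exists M.
Qed.

Lemma le_bounded_op T M : linear T -> (forall x, `|T x| <= M * `|x|) -> bounded_op T.
Proof.
move=> lT TM; split => //.
pose f : {linear H -> H} := HB.pack T (GRing.isLinear.Build R H H *:%R T lT).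
apply: (@bounded_linear_continuous _ _ _ f); apply/linear_boundedP.
near=> r => x; apply: le_trans (TM x) _; apply: ler_wpM2r => //.
Unshelve. all: by end_near. Qed.

Lemma bounded_op_cvg (X : Type) (F : set_system X) {FF : Filter F} T (u : X -> H) x :
  bounded_op T -> u t @[t --> F] --> x -> T (u t) @[t --> F] --> T x.
Proof. by move=> [_ cT] ux; apply: continuous_cvg => //; exact: cT. Qed.

Lemma bounded_op_id : bounded_op (@id H).
Proof. by split => // x; exact: cvg_id. Qed.

Lemma bounded_op_comp S T : bounded_op S -> bounded_op T -> bounded_op (S \o T).
Proof.
move=> [lS cS] [lT cT]; split => [a x y|x]; first by rewrite /= lT lS.
by apply: continuous_comp; [exact: cT|exact: cS].
Qed.

Lemma bounded_opD S T : bounded_op S -> bounded_op T ->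
  bounded_op (fun x => S x + T x).
Proof.
move=> [lS cS] [lT cT]; split => [a x y|x].
  by rewrite lT lS scalerDr addrACA.
by apply: cvgD; [exact: cS|exact: cT].
Qed.

Lemma bounded_opZ a T : bounded_op T -> bounded_op (fun x => a *: T x).
Proof.
move=> [lT cT]; split => [b x y|x].
  by rewrite lT scalerDr !scalerA mulrC.
by apply: cvgZr; exact: cT.
Qed.

Lemma bounded_op_plusI T g : bounded_op T -> bounded_op (plusI T g).
Proof. by move=> bT; apply: bounded_opD => //; apply: bounded_opZ; exact: bounded_op_id. Qed.

Lemma plusINK T a : plusI (plusI T (- a)) a = T.
Proof. by apply/funext => x; rewrite /plusI scaleNr subrK. Qed.

Section OneBasis.
Variable e : nat -> H.
Hypothesis eB : onb ip e.

Lemma onb_ip i j : ip (e i) (e j) = (i == j)%:R. Proof. by case: eB. Qed.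

Lemma onb_ortho i j : i != j -> ip (e i) (e j) = 0.
Proof. by rewrite onb_ip => /negbTE ->. Qed.

Lemma onb_ip1 i : ip (e i) (e i) = 1. Proof. by rewrite onb_ip eqxx. Qed.

Lemma onb_norm i : `|e i| = 1.
Proof. by apply/eqP; rewrite -sqrp_eq1// norm_ip onb_ip1. Qed.

Lemma onb_inj x y : (forall i, ip x (e i) = ip y (e i)) -> x = y.
Proof.
move=> xy; apply/eqP; rewrite -subr_eq0; apply/eqP.
by apply: eB.2 => i; rewrite ipBl xy subrr.
Qed.

Lemma onb_bessel x n : \sum_(k < n) ip x (e k) ^+ 2 <= `|x| ^+ 2.
Proof.
by apply: (bessel norm_ip) => [i j|i]; [exact: onb_ortho|rewrite onb_ip1].
Qed.

Lemma riesz_fischer (c : nat -> R) X : 0 <= X ->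
  (forall n, \sum_(k < n) c k ^+ 2 <= X ^+ 2) ->
  exists y, [/\ series (fun k => c k *: e k) @ \oo --> y,
    forall k, ip y (e k) = c k & `|y| <= X].
Proof.
move=> X0 cX; set s := series _.
have cc : cvgn (series (fun k => c k ^+ 2)).
  apply: (@nneg_series_is_cvg _ _ (X ^+ 2)) => [k|n]; first exact: sqr_ge0.
  by rewrite seriesE.
have normE m n : `|\sum_(m <= k < n) c k *: e k| ^+ 2 = \sum_(m <= k < n) c k ^+ 2.
  rewrite (norm_sum_ortho norm_ip) ?iota_uniq//; last exact: onb_ortho.
  by apply: eq_bigr => k _; rewrite onb_ip1 mulr1.
have cs : cvgn s.
  apply/cauchy_cvgP/cauchy_seriesP => eps eps0.
  move: cc => /cauchy_cvgP/cauchy_seriesP/(_ _ (exprn_gt0 2 eps0)).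
  apply: filterS => -[m n] /=; rewrite -normE ger0_norm ?sqr_ge0//.
  by rewrite ltr_sqr ?nnegrE// ltW.
exists (limn s); split => //.
- move=> k; have c1 : ip (s n) (e k) @[n --> \oo] --> ip (limn s) (e k).
    exact: (cvg_ipl norm_ip).
  rewrite -(cvg_lim _ c1)//; apply: cvg_lim => //; apply: cvg_near_cst.
  near=> n; have kn : (k < n)%N by near: n; exact: nbhs_infty_gt.
  rewrite /s seriesE ip_suml (bigD1 (Ordinal kn))//= big1 => [|j jk].
    by rewrite addr0 ipZl onb_ip1 mulr1.
  by rewrite ipZl onb_ortho ?mulr0.
- have c1 : `|s n| @[n --> \oo] --> `|limn s| by exact: cvg_norm.
  rewrite -(cvg_lim _ c1)//; apply: limr_le; first exact: cvgP c1.
  near=> n; rewrite -ler_sqr ?nnegrE// /s /series/= normE big_mkord; exact: cX.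
Unshelve. all: by end_near. Qed.

Lemma onb_expand x : series (fun k => ip x (e k) *: e k) @ \oo --> x.
Proof.
have [y [cy ye _]] := @riesz_fischer (fun k => ip x (e k)) `|x| (normr_ge0 _) (onb_bessel x).
have yx : y = x by apply: onb_inj => i; rewrite ye.
by rewrite yx in cy.
Qed.

Arguments onb_expand : clear implicits.

Lemma parseval x y : series (fun k => ip x (e k) * ip y (e k)) @ \oo --> ip x y.
Proof.
apply: eq_cvgn (cvg_ipl norm_ip y (onb_expand x)) => n.
rewrite /series/= !big_mkord ip_suml; apply: eq_bigr => k _.
by rewrite ipZl (ipC ip y).
Qed.

Arguments parseval : clear implicits.

Lemma bounded_op_eq_onb S T : bounded_op S -> bounded_op T ->
  (forall k, S (e k) = T (e k)) -> S = T.
Proof.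
move=> bS bT ST; apply/funext => x.
have c1 := [elaborate bounded_op_cvg bS (onb_expand x)].
have c2 := [elaborate bounded_op_cvg bT (onb_expand x)].
apply: (cvgn_unique c1); apply: eq_cvgn c2 => n; rewrite /series/= !big_mkord.
rewrite (linear_prop_sum bS.1) (linear_prop_sum bT.1); apply: eq_bigr => k _.
by rewrite (linear_propZ bS.1) (linear_propZ bT.1) ST.
Qed.

(** Riesz-Fischer at each [x]; the choice is automatically linear, since a vector is determined by
    its coordinates in [e]. *)
Lemma onb_op (phi : H -> nat -> R) M : 0 <= M -> (forall k, linear (phi^~ k : H -> R)) ->
  (forall x n, \sum_(k < n) phi x k ^+ 2 <= (M * `|x|) ^+ 2) ->
  exists D, bounded_op D /\ forall x k, ip (D x) (e k) = phi x k.
Proof.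
move=> M0 lphi phiM.
have /choice[D HD] x : exists y, (forall k, ip y (e k) = phi x k) /\ `|y| <= M * `|x|.
  have [|y [_ ye yM]] := riesz_fischer _ (phiM x); first by rewrite mulr_ge0.
  by exists y.
exists D; split => [|x]; last by have [] := HD x.
apply: (@le_bounded_op _ M) => [a x y|x]; last by have [] := HD x.
apply: onb_inj => i; rewrite ipDl ipZl !(HD _).1; exact: lphi.
Qed.

Lemma diag_op (lam : nat -> R) M : (forall k, `|lam k| <= M) ->
  exists D, [/\ bounded_op D, forall k, D (e k) = lam k *: e k &
    forall x k, ip (D x) (e k) = lam k * ip x (e k)].
Proof.
move=> lamM; have M0 : 0 <= M by apply: le_trans (lamM 0).
have [||D [bD DE]] := @onb_op (fun x k => lam k * ip x (e k)) M M0.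
- by move=> k a x y; rewrite ipDl ipZl mulrDr mulrCA.
- move=> x n; rewrite exprMn; apply: le_trans (ler_wpM2l (sqr_ge0 M) (onb_bessel x n)).
  rewrite mulr_sumr; apply: ler_sum => k _; rewrite exprMn.
  apply: ler_wpM2r; first exact: sqr_ge0.
  by rewrite -real_normK ?num_real// lerXn2r ?nnegrE.
- exists D; split => // k; apply: onb_inj => i; rewrite DE ipZl onb_ip.
  by have [->|] := eqVneq k i => //; rewrite !mulr0.
Qed.

Lemma eigen_selfadjoint T (lam : nat -> R) : bounded_op T ->
  (forall k, T (e k) = lam k *: e k) -> forall x y, ip (T x) y = ip x (T y).
Proof.
move=> bT Te.
have TE i z : ip (T z) (e i) = lam i * ip z (e i).
  have c1 := [elaborate cvg_ipl norm_ip (e i) (bounded_op_cvg bT (onb_expand z))].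
  apply/esym/(cvg_unique _ _ c1) => //; apply: cvg_near_cst.
  near=> n; have kn : (i < n)%N by near: n; exact: nbhs_infty_gt.
  rewrite /series/= big_mkord (linear_prop_sum bT.1) ip_suml (bigD1 (Ordinal kn))//= big1 => [|j jk].
    by rewrite (linear_propZ bT.1) Te !ipZl onb_ip1 addr0 mulr1 mulrC.
  by rewrite (linear_propZ bT.1) Te !ipZl onb_ortho ?mulr0.
move=> x y; apply: (cvgn_unique (parseval (T x) y)).
apply: eq_cvgn (parseval x (T y)) => n; rewrite /series/= !big_mkord.
by apply: eq_bigr => k _; rewrite !TE mulrCA mulrA.
Unshelve. all: by end_near. Qed.

Lemma adjoint_exists T : bounded_op T ->
  exists T', bounded_op T' /\ forall x y, ip (T x) y = ip x (T' y).
Proof.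
move=> bT; have [M M0 TM] := bounded_op_le bT.
have [|x n|T' [bT' T'E]] := @onb_op (fun x k => ip x (T (e k))) M (ltW M0).
- by move=> k; exact: ip_linl.
- set S := \sum_(_ < _) _.
  have S0 : 0 <= S by apply: sumr_ge0 => k _; exact: sqr_ge0.
  (* Testing against the partial sum itself: |z|^2 = <x, T z> <= M |x| |z|, hence |z| <= M |x|. *)
  set z := \sum_(k < n) ip x (T (e k)) *: e k.
  have Sz : S = ip x (T z).
    rewrite (linear_prop_sum bT.1) ip_sumr; apply: eq_bigr => k _.
    by rewrite (linear_propZ bT.1) ipZr.
  have nz : `|z| ^+ 2 = S.
    rewrite /z -(big_mkord xpredT (fun k => ip x (T (e k)) *: e k)).
    rewrite (norm_sum_ortho norm_ip) ?iota_uniq//; last exact: onb_ortho.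
    by rewrite big_mkord; apply: eq_bigr => k _; rewrite onb_ip1 mulr1.
  have h1 : S <= (M * `|x|) * `|z|.
    rewrite {1}Sz; apply: le_trans (ler_norm _) _.
    apply: le_trans (cauchy_schwarz norm_ip _ _) _.
    by rewrite -mulrA mulrCA; apply: ler_wpM2l => //; exact: TM.
  have [z0|z0] := eqVneq `|z| 0.
    by rewrite -nz z0 expr0n/= sqr_ge0.
  have zp : 0 < `|z| by rewrite lt_def z0 normr_ge0.
  move: h1; rewrite -nz expr2 ler_pM2r// => h1.
  by rewrite -expr2 lerXn2r ?nnegrE// mulr_ge0// ltW.
- exists T'; split => // x y.
  rewrite ipC.
  have c1 := parseval (T' y) x; rewrite (ipC ip x); apply: (cvg_unique _ _ c1) => //.
  apply: eq_cvgn (cvg_ipr norm_ip y (bounded_op_cvg bT (onb_expand x))) => n.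
  rewrite /series/= !big_mkord (linear_prop_sum bT.1) ip_sumr; apply: eq_bigr => k _.
  by rewrite (linear_propZ bT.1) ipZr T'E mulrC.
Qed.

End OneBasis.

Lemma adjoint_sym T T' : (forall x y, ip (T x) y = ip x (T' y)) ->
  forall x y, ip (T' x) y = ip x (T y).
Proof. by move=> TT' x y; rewrite ipC -TT' ipC. Qed.

End Onb.

Arguments onb_expand {R H ip} norm_ip {e} eB x.
Arguments parseval {R H ip} norm_ip {e} eB x y.

(** * Hilbert-Schmidt operators *)

Section HilbertSchmidt.
Variables (R : realType) (H : completeNormedModType R) (ip : {dot H for idfun}).
Hypothesis norm_ip : forall x : H, `|x| ^+ 2 = ip x x.
Implicit Types (x y z : H) (T S A C : H -> H) (e f : nat -> H).

(** Parseval in [f], exchange of the sums, then Bessel in [e], through <T e_k, f_j> = <e_k, T'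
    f_j>. *)
Lemma onb_sum_adjoint_le T T' e f X : onb ip e -> onb ip f ->
  (forall x y, ip (T x) y = ip x (T' y)) ->
  (forall n, \sum_(j < n) `|T' (f j)| ^+ 2 <= X) ->
  forall n, \sum_(k < n) `|T (e k)| ^+ 2 <= X.
Proof.
move=> eB fB TT' T'X n.
have c1 : \sum_(k < n) series (fun j => ip (T (e k)) (f j) * ip (T (e k)) (f j)) m
    @[m --> \oo] --> \sum_(k < n) `|T (e k)| ^+ 2.
  by apply: cvg_bigsum => k; rewrite norm_ip; exact: (parseval norm_ip fB).
rewrite -(cvg_lim _ c1)//; apply: limr_le; first exact: cvgP c1.
near=> m; apply: le_trans (T'X m).
under eq_bigr do rewrite seriesE.
rewrite exchange_big/=; apply: ler_sum => j _.
apply: le_trans (onb_bessel norm_ip eB (T' (f j)) n).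
by apply: ler_sum => k _; rewrite TT' ipC -expr2.
Unshelve. all: by end_near. Qed.

(** Going to the adjoint and back carries the bound from the basis of the definition to an arbitrary
    one. *)
Lemma hs_sum T e : hilbert_schmidt ip T -> onb ip e ->
  exists X, forall n, \sum_(k < n) `|T (e k)| ^+ 2 <= X.
Proof.
move=> [bT [g [gB cg]]] eB.
have [T' [bT' TT']] := adjoint_exists norm_ip gB bT.
exists (limn (series (fun k => `|T (g k)| ^+ 2))).
apply: (onb_sum_adjoint_le eB gB TT').
apply: (onb_sum_adjoint_le gB gB (adjoint_sym TT')) => n.
rewrite -(seriesE (fun k => `|T (g k)| ^+ 2)).
by apply: nneg_series_le_lim cg => k; exact: sqr_ge0.
Qed.

Lemma hsP T e X : bounded_op T -> onb ip e ->
  (forall n, \sum_(k < n) `|T (e k)| ^+ 2 <= X) -> hilbert_schmidt ip T.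
Proof.
move=> bT eB TX; split => //; exists e; split => //.
apply: (@nneg_series_is_cvg _ _ X) => [k|n]; first exact: sqr_ge0.
by rewrite seriesE.
Qed.

Lemma hs_is_cvg T e : hilbert_schmidt ip T -> onb ip e ->
  cvgn (series (fun k => `|T (e k)| ^+ 2)).
Proof.
move=> hT eB; have [X TX] := hs_sum hT eB.
apply: (@nneg_series_is_cvg _ _ X) => [k|n]; first exact: sqr_ge0.
by rewrite seriesE.
Qed.

Lemma hsD S T : hilbert_schmidt ip S -> hilbert_schmidt ip T ->
  hilbert_schmidt ip (fun x => S x + T x).
Proof.
move=> hS hT; have [bS [e [eB _]]] := hS.
have [X SX] := hs_sum hS eB; have [Y TY] := hs_sum hT eB.
apply: (@hsP _ e (2 * X + 2 * Y)) => //; first by apply: bounded_opD => //; case: hT.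
move=> n; apply: le_trans (lerD (ler_wpM2l _ (SX n)) (ler_wpM2l _ (TY n))) => //.
rewrite !mulr_sumr -big_split/=; apply: ler_sum => k _.
have : `|S (e k) + T (e k)| ^+ 2 <= (`|S (e k)| + `|T (e k)|) ^+ 2.
  by rewrite lerXn2r ?nnegrE ?addr_ge0//; exact: ler_normD.
move/le_trans; apply.
have : 0 <= (`|S (e k)| - `|T (e k)|) ^+ 2 by exact: sqr_ge0.
rewrite sqrrB sqrrD; lra.
Qed.

Lemma hs_compl C T : bounded_op C -> hilbert_schmidt ip T ->
  hilbert_schmidt ip (C \o T).
Proof.
move=> bC hT; have [bT [e [eB _]]] := hT.
have [X TX] := hs_sum hT eB; have [M M0 CM] := bounded_op_le bC.
apply: (@hsP _ e (M ^+ 2 * X)) => //; first exact: bounded_op_comp.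
move=> n; apply: le_trans (ler_wpM2l (sqr_ge0 M) (TX n)).
rewrite mulr_sumr; apply: ler_sum => k _ /=.
by rewrite -exprMn lerXn2r ?nnegrE ?mulr_ge0// ltW.
Qed.

Lemma hsZ a T : hilbert_schmidt ip T -> hilbert_schmidt ip (fun x => a *: T x).
Proof.
by move=> hT; apply: (@hs_compl ( *:%R a)) => //; apply: bounded_opZ; exact: bounded_op_id.
Qed.

Lemma hs_adjoint T T' : bounded_op T' -> (forall x y, ip (T x) y = ip x (T' y)) ->
  hilbert_schmidt ip T -> hilbert_schmidt ip T'.
Proof.
move=> bT' TT' hT; have [bT [e [eB _]]] := hT.
have [X TX] := hs_sum hT eB; apply: (@hsP _ e X) => //.
exact: (onb_sum_adjoint_le eB eB (adjoint_sym TT')).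
Qed.

Lemma hs_compr C T : bounded_op C -> hilbert_schmidt ip T ->
  hilbert_schmidt ip (T \o C).
Proof.
move=> bC hT; have [bT [e [eB _]]] := hT.
have [T' [bT' TT']] := adjoint_exists norm_ip eB bT.
have [C' [bC' CC']] := adjoint_exists norm_ip eB bC.
apply: (@hs_adjoint (C' \o T')); first exact: bounded_op_comp.
  by move=> x y /=; rewrite (adjoint_sym CC') (adjoint_sym TT').
by apply: hs_compl => //; exact: hs_adjoint TT' hT.
Qed.

(** Otherwise (a - b) I would be Hilbert-Schmidt, with a nonzero constant series. Infinite dimension
    is hidden in [onb], whose families are indexed by all of [nat]. *)
Lemma hs_scalar_uniq T a b : hilbert_schmidt ip (plusI T a) ->
  hilbert_schmidt ip (plusI T b) -> a = b.
Proof.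
move=> ha hb; have [_ [e [eB _]]] := ha.
have := hs_is_cvg (hsD ha (hsZ (-1) hb)) eB.
have -> : (fun k => `|plusI T a (e k) + -1 *: plusI T b (e k)| ^+ 2) = fun=> (a - b) ^+ 2.
  apply/funext => k; rewrite /plusI scaleN1r opprD addrACA subrr add0r -scalerBl.
  by rewrite normrZ (onb_norm norm_ip eB) mulr1 real_normK ?num_real.
move=> /cvg_series_cvg_0 c0; apply/eqP; rewrite -subr_eq0 -(sqrf_eq0 (a - b)).
by apply/eqP; apply: (cvgn_unique _ c0); exact: cvg_cst.
Qed.

Lemma hs_cvg0 T e : hilbert_schmidt ip T -> onb ip e ->
  `|T (e k)| @[k --> \oo] --> (0 : R).
Proof.
move=> hT eB; have /cvg_series_cvg_0 c0 := hs_is_cvg hT eB.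
apply/cvgrPdist_lt => eps eps0.
move/cvgrPdist_lt : c0 => /(_ _ (exprn_gt0 2 eps0)); apply: filterS => k.
by rewrite !sub0r !normrN normr_id ger0_norm ?sqr_ge0// ltr_sqr ?nnegrE// ltW.
Qed.

End HilbertSchmidt.

(** * The spectral theorem *)

Lemma ultra_fmap (T U : Type) (F : set_system T) (f : T -> U) :
  UltraFilter F -> UltraFilter (f @ F).
Proof.
move=> FU; split=> [|G GF FG]; first exact: fmap_proper_filter.
apply/seteqP; split => // A GA.
have [//|FA] := in_ultra_setVsetC (f @^-1` A) FU.
have GAC : G (~` A) by apply: FG.
have := filterI GA GAC; rewrite setICr => G0.
by case: (@filter_not_empty _ G GF); exact: G0.
Qed.

(** An ultrafilter stands in for a diagonal extraction: all bounded coordinates converge along it at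
    once. *)
Lemma ultra_real_cvg (R : realType) (T : Type) (F : set_system T) (f : T -> R) (M : R) :
  UltraFilter F -> (\forall x \near F, `|f x| <= M) ->
  exists c : R, f x @[x --> F] --> c.
Proof.
move=> FU fM; have := @segment_compact R (- M) M.
rewrite compact_ultra => /(_ (f @ F) (ultra_fmap f FU)) [|c [_ fc]]; last by exists c.
by apply: filterS fM => x; rewrite /= in_itv/= ler_norml.
Qed.

Section Eigenvector.
Variables (R : realType) (H : completeNormedModType R) (ip : {dot H for idfun}).
Hypothesis norm_ip : forall x : H, `|x| ^+ 2 = ip x x.
Variable T : H -> H.
Hypotheses (hT : hilbert_schmidt ip T) (sT : forall x y, ip (T x) y = ip x (T y)).

(* Along [F] the bounded coordinates [<x, e_k>] converge, and the tails
   [sum_(k >= K) |T e_k|^2] make the truncation error uniformly small. *)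
Lemma hs_ultra_cvg (F : set_system H) : UltraFilter F ->
  (\forall x \near F, `|x| = 1) -> exists y : H, T x @[x --> F] --> y.
Proof.
move=> FU F1; have FP : ProperFilter F by exact: ultra_proper.
have [bT [e [eB _]]] := hT.
have /choice[c cE] k : exists c : R, ip x (e k) @[x --> F] --> c.
  apply: (@ultra_real_cvg _ _ _ _ 1) => //; apply: filterS F1 => x x1.
  apply: le_trans (cauchy_schwarz norm_ip _ _) _.
  by rewrite x1 (onb_norm norm_ip eB) mulr1.
suff : cauchy_ex (T x @[x --> F]).
  by move/cauchy_exP/cauchy_cvg => cF; exists (lim (T x @[x --> F])).
move=> eps eps0; pose d := eps / 2; have d0 : 0 < d by rewrite divr_gt0.
have [K tailK] : exists K, forall n, \sum_(K <= k < n) `|T (e k)| ^+ 2 <= d ^+ 2.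
  have cT := hs_is_cvg norm_ip hT eB.
  have /cvgrPdist_lt/(_ _ (exprn_gt0 2 d0)) [K _ KH] := cT.
  exists K => n; have [nK|Kn] := leqP n K; first by rewrite big_geq// sqr_ge0.
  rewrite -(sub_series_geq _ (ltnW Kn)); apply: ltW.
  have := KH K (leqnn K); rewrite ltr_norml => /andP[_]; apply: le_lt_trans.
  by rewrite lerD2r nneg_series_le_lim// => k; exact: sqr_ge0.
exists (\sum_(k < K) c k *: T (e k)).
have c1 : `|\sum_(k < K) ip x (e k) *: T (e k) - \sum_(k < K) c k *: T (e k)|
    @[x --> F] --> `|\sum_(k < K) c k *: T (e k) - \sum_(k < K) c k *: T (e k)|.
  apply: cvg_norm; apply: cvgB; last exact: cvg_cst.
  by apply: cvg_bigsum => k; apply: cvgZl; exact: cE.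
have /cvgrPdist_lt/(_ _ d0) {}c1 := c1.
change (\forall x \near F, ball (\sum_(k < K) c k *: T (e k)) eps (T x)).
near=> x; have x1 : `|x| = 1 by near: x.
have h1 : `|\sum_(k < K) ip x (e k) *: T (e k) - \sum_(k < K) c k *: T (e k)| < d.
  have : `| `|\sum_(k < K) c k *: T (e k) - \sum_(k < K) c k *: T (e k)| -
            `|\sum_(k < K) ip x (e k) *: T (e k) - \sum_(k < K) c k *: T (e k)| | < d.
    by near: x.
  by rewrite subrr normr0 sub0r normrN normr_id.
have h2 : `|T x - \sum_(k < K) ip x (e k) *: T (e k)| <= d.
  have cx : T (series (fun k => ip x (e k) *: e k) n) @[n --> \oo] --> T x.
    by apply: bounded_op_cvg => //; exact: onb_expand.
  have c2 : `|T (series (fun k => ip x (e k) *: e k) n) -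
      \sum_(k < K) ip x (e k) *: T (e k)| @[n --> \oo] -->
      `|T x - \sum_(k < K) ip x (e k) *: T (e k)|.
    by apply: cvg_norm; apply: cvgB => //; exact: cvg_cst.
  rewrite -(cvg_lim _ c2)//; apply: limr_le; first exact: cvgP c2.
  near=> n; have Kn : (K <= n)%N by near: n; exact: nbhs_infty_ge.
  rewrite /series/= (linear_prop_sum bT.1).
  under [X in `|X - _|]eq_bigr do rewrite (linear_propZ bT.1).
  rewrite (big_cat_nat (leq0n K) Kn)//= [X in X - _]addrC big_mkord addrK.
  apply: le_trans (ler_norm_sum _ _ _) _.
  (* Young's inequality with weight [d]: the coordinates have square sum at most 1 and the tail of T
     at most d^2, so the total is d / 2 + d / 2. *)
  have le1 k : `|ip x (e k) *: T (e k)| <= d / 2 * ip x (e k) ^+ 2 +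
      (d *+ 2)^-1 * `|T (e k)| ^+ 2.
    rewrite normrZ -[X in d / 2 * X]real_normK ?num_real//.
    set a := `|ip _ _|; set b := `|T _|.
    have -> : d / 2 * a ^+ 2 + (d *+ 2)^-1 * b ^+ 2 = a * b + (d * a - b) ^+ 2 / (d *+ 2).
      by field; rewrite gt_eqF.
    by rewrite lerDl divr_ge0 ?sqr_ge0// mulrn_wge0// ltW.
  apply: le_trans (ler_sum _ (fun k _ => le1 k)) _.
  rewrite big_split/= -!mulr_sumr.
  have le2 : \sum_(K <= k < n) ip x (e k) ^+ 2 <= 1.
    have := onb_bessel norm_ip eB x n; rewrite x1 expr1n; apply: le_trans.
    rewrite -(big_mkord xpredT (fun k => ip x (e k) ^+ 2)) (big_cat_nat (leq0n K) Kn)//=.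
    by rewrite lerDr sumr_ge0// => k _; exact: sqr_ge0.
  have d2 : 0 < (d *+ 2)^-1 by rewrite invr_gt0 mulrn_wgt0.
  have := lerD (ler_wpM2l (ltW (divr_gt0 d0 (ltr0Sn _ 1))) le2) (ler_wpM2l (ltW d2) (tailK n)).
  move/le_trans; apply.
  have -> : d / 2 * 1 + (d *+ 2)^-1 * d ^+ 2 = d by field; rewrite gt_eqF.
  by [].
rewrite -ball_normE /ball_/= distrC.
rewrite -(subrKA (\sum_(k < K) ip x (e k) *: T (e k))).
apply: le_lt_trans (ler_normD _ _) _.
have -> : eps = d + d by rewrite /d; lra.
by apply: ler_ltD.
Unshelve. all: by end_near. Qed.

(** Let [s] be the supremum of |T x|^2 over unit vectors of the invariant space V. Along a
    maximizing ultrafilter T T x - s x tends to 0 and T x converges, so for s > 0 the vector x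
    converges to a unit [w] with T T w = s w. With q = sqrt s this reads (T - q) (T + q) w = 0:
    either T w = - q w, or T w + q w is an eigenvector for q. Using |T x|^2 rather than <x, T x>
    treats both signs at once. *)
Lemma hs_eigenvector (E : set H) (V := fun x => forall v, E v -> ip x v = 0) x0 :
  (forall x, V x -> V (T x)) -> V x0 -> x0 != 0 ->
  exists y lam, [/\ V y, `|y| = 1 & T y = lam *: y].
Proof.
move=> VT Vx0 x00; have bT := hT.1.
have VZ a x : V x -> V (a *: x) by move=> Vx v Ev; rewrite ipZl Vx ?mulr0.
have VD x y : V x -> V y -> V (x + y) by move=> Vx Vy v Ev; rewrite ipDl Vx ?Vy ?addr0.
have Vunit x : V x -> x != 0 -> V (`|x|^-1 *: x) /\ `| `|x|^-1 *: x| = 1.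
  move=> Vx xn0; split; first exact: VZ.
  by rewrite normrZ normfV normr_id mulVf// normr_eq0.
pose B := [set `|T x| ^+ 2 | x in [set x | V x /\ `|x| = 1]].
have [M M0 TM] := bounded_op_le bT.
have hsB : has_sup B.
  split; last first.
    exists (M ^+ 2) => _ [x [_ x1] <-]; apply: lerXn2r; rewrite ?nnegrE ?(ltW M0)//.
    by have := TM x; rewrite x1 mulr1.
  have [? ?] := Vunit _ Vx0 x00.
  by exists (`|T (`|x0|^-1 *: x0)| ^+ 2); exists (`|x0|^-1 *: x0).
pose s := sup B.
have Bs x : V x -> `|T x| ^+ 2 <= s * `|x| ^+ 2.
  move=> Vx; have [->|xn0] := eqVneq x 0.
    by rewrite (linear_prop0 bT.1) normr0 expr0n mulr0.
  have [Vu u1] := Vunit _ Vx xn0.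
  have : `|T (`|x|^-1 *: x)| ^+ 2 <= s by apply: (ub_le_sup hsB.2); exists (`|x|^-1 *: x).
  rewrite (linear_propZ bT.1) normrZ normfV normr_id exprMn exprVn mulrC.
  by rewrite ler_pdivrMr// exprn_gt0// normr_gt0.
have s0 : 0 <= s.
  have [Vu u1] := Vunit _ Vx0 x00.
  by have := Bs _ Vu; rewrite u1 expr1n mulr1; apply: le_trans; exact: sqr_ge0.
have [s_eq0|sn0] := eqVneq s 0.
  have [Vu u1] := Vunit _ Vx0 x00.
  exists (`|x0|^-1 *: x0), 0; split => //; rewrite scale0r.
  apply/eqP; rewrite -normr_eq0 -sqrf_eq0 eq_le sqr_ge0 andbT.
  by have := Bs _ Vu; rewrite s_eq0 mul0r.
have sp : 0 < s by rewrite lt_def sn0.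
pose D := fun eps => [set x | [/\ V x, `|x| = 1 & s - eps < `|T x| ^+ 2]].
have FD : ProperFilter (filter_from [set eps : R | 0 < eps] D).
  apply: filter_from_proper.
    apply: filter_from_filter; first by exists 1; rewrite /=.
    move=> i j /= i0 j0; exists (Num.min i j); first by rewrite /= lt_min i0.
    move=> x [Vx x1 sx]; split; split => //; apply: le_lt_trans sx.
      by rewrite lerD2l lerN2 ge_min lexx.
    by rewrite lerD2l lerN2 ge_min lexx orbT.
  move=> eps /= eps0.
  have [_ [x [Vx x1] <-] sx] := sup_adherent eps0 hsB.
  by exists x; split.
have [F [FU DF]] := ultraFilterLemma FD.
have FP : ProperFilter F by exact: ultra_proper.
have nearD eps : 0 < eps -> \forall x \near F, D eps x.
  by move=> eps0; apply: DF; exists eps.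
have F1 : \forall x \near F, `|x| = 1.
  by apply: filterS (nearD 1 ltr01) => x [].
have FV : \forall x \near F, V x by apply: filterS (nearD 1 ltr01) => x [].
have [y Ty] := hs_ultra_cvg FU F1.
pose w := s^-1 *: T y.
(* Self-adjointness and |T T x|^2 <= s |T x|^2 bound the expanded square by s (s - |T x|^2); the
   factor 2 is slack. *)
have TT x : V x -> `|x| = 1 -> `|T (T x) - s *: x| ^+ 2 <= s * (s - `|T x| ^+ 2) *+ 2.
  move=> Vx x1.
  have h := Bs _ (VT _ Vx); have := Bs _ Vx; rewrite x1 expr1n mulr1 => h'.
  rewrite norm_ip ipBl !ipBr !ipZl !ipZr -!norm_ip (ipC ip x) sT -norm_ip x1.
  rewrite expr1n mulr1; nra.
have cw : x @[x --> F] --> w.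
  have c1 : s^-1 *: T (T x) @[x --> F] --> w.
    by apply: cvgZr; exact: bounded_op_cvg.
  have c2 : s^-1 *: (T (T x) - s *: x) @[x --> F] --> (0 : H).
    rewrite -[0 in X in _ --> X](scaler0 _ s^-1); apply: cvgZr.
    apply/cvgr0Pnorm_lt => eps eps0.
    have d0 : 0 < eps ^+ 2 / (s *+ 2).
      by rewrite divr_gt0 ?exprn_gt0// mulrn_wgt0.
    apply: filterS (nearD _ d0) => x [Vx x1 sx].
    rewrite -ltr_sqr ?nnegrE// ?ltW//; apply: le_lt_trans (TT _ Vx x1) _.
    have : s - `|T x| ^+ 2 < eps ^+ 2 / (s *+ 2) by lra.
    rewrite ltr_pdivlMr; last by rewrite mulrn_wgt0.
    by rewrite mulrC mulrnAl.
  have c3 : s^-1 *: T (T x) - s^-1 *: (T (T x) - s *: x) @[x --> F] --> w.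
    by rewrite -[w]subr0; exact: cvgB c1 c2.
  suff <- : (fun x => s^-1 *: T (T x) - s^-1 *: (T (T x) - s *: x)) = id by [].
  apply/funext => x; rewrite scalerBr scalerA mulVf// scale1r opprB addrC subrK.
  by [].
have Tw : T w = y.
  have c : T x @[x --> F] --> T w by exact: bounded_op_cvg.
  exact: (cvg_unique (@norm_hausdorff _ _) c Ty).
have Ty' : T y = s *: w by rewrite /w scalerA mulfV// scale1r.
clearbody w.
have w1 : `|w| = 1.
  have c : `|x| @[x --> F] --> `|w| by exact: cvg_norm.
  rewrite -(cvg_lim _ c)//; apply: cvg_lim => //; apply: cvg_near_cst.
  exact: F1.
have Vw : V w.
  move=> v Ev; have c : ip x v @[x --> F] --> ip w v by exact: (cvg_ipl norm_ip).
  rewrite -(cvg_lim _ c)//; apply: cvg_lim => //; apply: cvg_near_cst.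
  by apply: filterS FV => x; exact.
pose q := Num.sqrt s.
have qq : q * q = s by rewrite -expr2 sqr_sqrtr.
pose p := T w + q *: w.
have Vp : V p by apply: VD; [exact: VT|exact: VZ].
have [p0|pn0] := eqVneq p 0.
  exists w, (- q); split => //; apply/eqP; rewrite scaleNr -addr_eq0; exact/eqP.
have [Vu u1] := Vunit _ Vp pn0.
exists (`|p|^-1 *: p), q; split => //.
rewrite (linear_propZ bT.1) scalerA mulrC -scalerA; congr (_ *: _).
have -> : T p = T (T w) + q *: T w by rewrite (linear_propD bT.1) (linear_propZ bT.1).
by rewrite /p Tw Ty' scalerDr scalerA qq addrC.
Qed.

End Eigenvector.

(** * Enumerating a maximal orthonormal set of eigenvectors *)

Section SpectralTheorem.
Variables (R : realType) (H : completeNormedModType R) (ip : {dot H for idfun}).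
Hypothesis norm_ip : forall x : H, `|x| ^+ 2 = ip x x.
Hypotheses (sepH : separable H) (infH : ~ finite_dim H).

Definition orthonormal_set (E : set H) :=
  (forall x, E x -> `|x| = 1) /\ (forall x y, E x -> E y -> x <> y -> ip x y = 0).

(** Distinct elements are at distance sqrt 2, too far for one point of the dense set to be within
    1/2 of both. *)
Lemma orthonormal_countable (E : set H) : orthonormal_set E -> countable E.
Proof.
move=> [E1 E0]; have [S /countable_injP[g gS] dS] := sepH.
have /choice[h Hh] x : exists s, S s /\ `|x - s| < 2^-1.
  have [|s [xs Ss]] := dS (ball x 2^-1) _ (ball_open _ _).
    by exists x; apply: ballxx; rewrite invr_gt0.
  by exists s; split => //; move: xs; rewrite -ball_normE.
apply/countable_injP; exists (g \o h) => x y /set_mem Ex /set_mem Ey gxy.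
have hxy : h x = h y.
  by apply: gS gxy; apply/mem_set; case: (Hh x) => //; case: (Hh y).
apply: contrapT => nxy.
have lt1 : `|x - y| < 1.
  rewrite -(subrKA (h x)); apply: le_lt_trans (ler_normD _ _) _.
  have -> : (1 : R) = 2^-1 + 2^-1 by lra.
  by apply: ltrD; [case: (Hh x)|rewrite hxy distrC; case: (Hh y)].
have : `|x - y| ^+ 2 < 1 by rewrite expr_lt1.
rewrite norm_ip ipBl !ipBr (ipC ip y x) (E0 _ _ Ex Ey nxy) -!norm_ip.
by rewrite E1// E1//; lra.
Qed.

Definition complete_set (E : set H) := forall x, (forall v, E v -> ip x v = 0) -> x = 0.

(** Infinite dimension enters here: a vector minus its projection on a finite complete set is
    orthogonal to that set, hence zero, so the set would span. *)
Lemma complete_infinite (E : set H) : orthonormal_set E -> complete_set E ->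
  infinite_set E.
Proof.
move=> [E1 E0] Ec /finite_seqP[s Es]; apply: infH.
pose u := undup s.
have Eu x : E x <-> x \in u by rewrite Es /= mem_undup.
exists (size u), (fun i => u`_i) => x.
exists (fun i => ip x u`_i).
apply/eqP; rewrite -subr_eq0; apply/eqP; apply: Ec => v /Eu vu.
rewrite ipBl ip_suml.
have iu : (index v u < size u)%N by rewrite index_mem.
rewrite (bigD1 (Ordinal iu))//= big1 => [|j jv].
  by rewrite nth_index// ipZl -(norm_ip v) E1 ?Eu// expr1n mulr1 addr0 subrr.
rewrite ipZl E0 ?mulr0//; first by apply/Eu; rewrite mem_nth.
  exact/Eu.
move=> uv; move/eqP : jv; apply; apply: val_inj => /=.
by rewrite -uv index_uniq// undup_uniq.
Qed.

Lemma onb_of_set (E : set H) : orthonormal_set E -> complete_set E ->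
  exists2 e, onb ip e & forall k, E (e k).
Proof.
move=> oE cE; have [E1 E0] := oE.
have : ([set: nat] #= E)%card.
  rewrite card_eq_le; apply/andP; split; last exact: orthonormal_countable.
  exact/infiniteP/complete_infinite.
move=> /card_set_bijP[e [eE ei es]].
have Ee k : E (e k) by apply: eE.
exists e => //; split => [i j|x xe].
  have [->|ij] := eqVneq i j; first by rewrite -norm_ip E1// expr1n.
  rewrite E0// => eij; move/eqP : ij; apply; apply: ei => //; exact: mem_setT.
by apply: cE => v /es [k _ <-].
Qed.

Theorem hs_spectral (T : H -> H) : hilbert_schmidt ip T -> selfadjoint ip T ->
  exists e (lam : nat -> R), onb ip e /\ forall k, T (e k) = lam k *: e k.
Proof.
move=> hT [bT sT].
pose P (E : set H) := orthonormal_set E /\ forall x, E x -> exists lam : R, T x = lam *: x.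
have [|E [[oE eE] maxE]] := @Zorn_bigcup _ P.
  move=> F FP totF; split; last by move=> x [A FA Ax]; case: (FP _ FA) => _; exact.
  split=> [x [A FA Ax]|x y [A FA Ax] [B FB By] xy].
    by case: (FP _ FA) => -[+ _] _; exact.
  have [AB|BA] := totF _ _ FA FB.
    by case: (FP _ FB) => -[_ h] _; apply: h => //; exact: AB.
  by case: (FP _ FA) => -[_ h] _; apply: h => //; exact: BA.
(* The orthogonal complement of eigenvectors is invariant under a self-adjoint [T]; a unit
   eigenvector found there could be added to [E]. *)
have cE : complete_set E.
  move=> x xE; apply: contrapT => /eqP x0.
  have [|y [mu [yE y1 Ty]]] := hs_eigenvector norm_ip hT sT _ xE x0.
    move=> z zE v Ev; have [mu Tv] := eE _ Ev.
    by rewrite sT Tv ipZr zE ?mulr0.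
  have nEy : ~ E y.
    move=> Ey; have := yE _ Ey; rewrite -norm_ip y1 expr1n => /eqP.
    by rewrite oner_eq0.
  apply: (maxE (E `|` [set y])).
    split; first by move=> z Ez; left.
    by move=> /(_ y) h; apply: nEy; apply: h; right.
  split; last by move=> z [/eE//|->]; exists mu.
  split=> [z [/oE.1//|->//]|z z'].
  case=> [Ez|->] [Ez'|->] zz' //; first exact: oE.2.
    by rewrite ipC yE.
  exact: yE.
have [e eB Ee] := onb_of_set oE cE.
have /choice[lam Hlam] k : exists lam : R, T (e k) = lam *: e k by apply: eE.
by exists e, lam.
Qed.

End SpectralTheorem.

(** * Functional calculus *)

Section FunctionalCalculus.
Variables (R : realType) (H : completeNormedModType R) (ip : {dot H for idfun}).
Hypothesis norm_ip : forall x : H, `|x| ^+ 2 = ip x x.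
Implicit Types (x y z : H) (T S A C P Q : H -> H) (e f : nat -> H).

(** Self-adjointness leaves [x] with coordinates only along the e_k with lam_k = l, where [Q] acts
    as h l. This removes the dependence on the eigenbasis picked in [spectral_fun]. *)
Lemma eigen_transfer T Q e (lam : nat -> R) (h : R -> R) l x : onb ip e ->
  bounded_op T -> (forall k, T (e k) = lam k *: e k) ->
  bounded_op Q -> (forall k, Q (e k) = h (lam k) *: e k) ->
  T x = l *: x -> Q x = h l *: x.
Proof.
move=> eB bT Te bQ Qe Tx; apply: (onb_inj eB) => k.
rewrite (eigen_selfadjoint norm_ip eB bQ Qe) Qe ipZr ipZl.
have : l * ip x (e k) = lam k * ip x (e k).
  by rewrite -ipZl -Tx (eigen_selfadjoint norm_ip eB bT Te) Te ipZr.
have [->|x0] := eqVneq (ip x (e k)) 0; first by rewrite !mulr0.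
by move=> /(mulIf x0) ->.
Qed.

Lemma spectral_funP T e (lam : nat -> R) (h : R -> R) M : onb ip e ->
  bounded_op T -> (forall k, T (e k) = lam k *: e k) ->
  (forall k, `|h (lam k)| <= M) ->
  bounded_op (spectral_fun ip h T) /\
  forall k, spectral_fun ip h T (e k) = h (lam k) *: e k.
Proof.
move=> eB bT Te hM.
have [|bQ [e' [lam' [eB' He']]]] := @getPex _ [set Q | bounded_op Q /\
    exists e (lam : nat -> R), onb ip e /\
      forall k, T (e k) = lam k *: e k /\ Q (e k) = h (lam k) *: e k].
  have [D [bD De _]] := diag_op norm_ip eB hM.
  by exists D; split => //; exists e, lam.
split => // k; apply: (eigen_transfer (lam := lam') eB' bT _ bQ _ (Te k)).
- by move=> j; have [] := He' j.
- by move=> j; have [] := He' j.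
Qed.

Lemma iter_bounded T M x k : 0 <= M -> (forall x, `|T x| <= M * `|x|) ->
  `|iter k T x| <= M ^+ k * `|x|.
Proof.
move=> M0 TM; elim: k => [|k IH]; first by rewrite expr0 mul1r.
rewrite /= exprS -mulrA; apply: le_trans (TM _) _.
exact: ler_wpM2l.
Qed.

Lemma op_exp_normed_cvg T M x : 0 <= M -> (forall x, `|T x| <= M * `|x|) ->
  cvgn [normed series (fun k => (k`!%:R)^-1 *: iter k T x)] /\
  limn [normed series (fun k => (k`!%:R)^-1 *: iter k T x)] <= expR M * `|x|.
Proof.
move=> M0 TM; set u := fun k => _.
have le_u k : `| `|u k| | <= `|x| * exp_coeff M k.
  rewrite normr_id normrZ ger0_norm ?invr_ge0 ?ler0n// /exp_coeff/= mulrC mulrA.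
  apply: ler_wpM2r; first by rewrite invr_ge0 ler0n.
  by rewrite mulrC; exact: iter_bounded.
have cb : cvgn (series (fun k => `|x| * exp_coeff M k)).
  by apply: is_cvg_seriesZ; exact: is_cvg_series_exp_coeff.
have cu := le_norm_series_is_cvg le_u cb; split => //.
have := series_tail_le 0 le_u cb.
rewrite !seriesE !big_ord0 !subr0 => /(le_trans (ler_norm _)) /le_trans; apply.
by rewrite (@lim_seriesZ _ (exp_coeff M) `|x| (is_cvg_series_exp_coeff M)) mulrC.
Qed.

Lemma op_exp_cvg T x : bounded_op T ->
  cvgn (series (fun k => (k`!%:R)^-1 *: iter k T x)).
Proof.
move=> bT; have [M M0 TM] := bounded_op_le bT.
by apply: normed_cvg; have [] := op_exp_normed_cvg x (ltW M0) TM.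
Qed.

Lemma linear_iter T k : linear T -> linear (iter k T).
Proof. by move=> lT; elim: k => [//|k IH] a x y /=; rewrite IH lT. Qed.

Lemma op_exp_bounded T : bounded_op T -> bounded_op (op_exp T).
Proof.
move=> bT; have [M M0 TM] := bounded_op_le bT.
apply: (@le_bounded_op _ _ _ (expR M)) => [a x y|x]; last first.
  have [cn ln] := op_exp_normed_cvg x (ltW M0) TM.
  by apply: le_trans ln; exact: lim_series_norm.
apply: cvg_lim => //.
set u := fun x k => (k`!%:R)^-1 *: iter k T x.
have c1 : a *: series (u x) n + series (u y) n @[n --> \oo] --> a *: op_exp T x + op_exp T y.
  by apply: cvgD; [apply: cvgZr|]; exact: op_exp_cvg.
apply: eq_cvgn c1 => n; rewrite /= /series/= scaler_sumr -big_split/=.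
by apply: eq_bigr => k _; rewrite (linear_iter k bT.1) scalerDr !scalerA mulrC.
Qed.

Lemma op_exp_eigen T x (t : R) : bounded_op T -> T x = t *: x ->
  op_exp T x = expR t *: x.
Proof.
move=> bT Tx.
have itE k : iter k T x = t ^+ k *: x.
  elim: k => [|k IH]; first by rewrite expr0 scale1r.
  by rewrite /= IH (linear_propZ bT.1) Tx scalerA -exprSr.
apply: cvg_lim => //.
have c1 : series (exp_coeff t) n *: x @[n --> \oo] --> expR t *: x.
  by apply: cvgZl; exact: is_cvg_series_exp_coeff.
apply: eq_cvgn c1 => n; rewrite /= /series/= scaler_suml.
by apply: eq_bigr => k _; rewrite itE scalerA mulrC.
Qed.

(** The lower bound [m] keeps the logarithms of the eigenvalues bounded. The second clause covers
    every eigenvector, not just the e_k, so that it can be transported through a similarity. *)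
Lemma op_powP P e (lam : nat -> R) m s : onb ip e -> bounded_op P ->
  (forall k, P (e k) = lam k *: e k) -> 0 < m -> (forall k, m <= lam k) ->
  bounded_op (op_pow ip P s) /\
  (forall l x, P x = l *: x -> x != 0 -> op_pow ip P s x = (l `^ s) *: x).
Proof.
move=> eB bP Pe m0 mlam; have [M M0 PM] := bounded_op_le bP.
have lamM k : lam k <= M.
  have := PM (e k); rewrite Pe normrZ (onb_norm norm_ip eB) !mulr1.
  by apply: le_trans; exact: ler_norm.
have lnM k : `|ln (lam k)| <= `|ln m| + `|ln M|.
  have l0 : 0 < lam k by exact: lt_le_trans (mlam k).
  rewrite ler_norml; apply/andP; split.
    have : ln m <= ln (lam k) by rewrite ler_ln.
    have := ler_norm (- ln m); rewrite normrN.
    have := normr_ge0 (ln M); lra.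
  have : ln (lam k) <= ln M by rewrite ler_ln.
  have := ler_norm (ln M); have := normr_ge0 (ln m); lra.
have [bL Le] := spectral_funP eB bP Pe lnM.
have bsL := bounded_opZ s bL; split; first exact: op_exp_bounded.
move=> l x Px x0.
have Lx : op_log ip P x = ln l *: x := eigen_transfer eB bP Pe bL Le Px.
rewrite /op_pow (op_exp_eigen (t := s * ln l))//; last by rewrite Lx scalerA.
have [k xk] : exists k, ip x (e k) != 0.
  apply: contrapT => h; move/eqP : x0; apply; apply: eB.2 => k.
  by apply/eqP; apply: contrapT => /negP hk; apply: h; exists k.
have l0 : 0 < l.
  have : l * ip x (e k) = lam k * ip x (e k).
    by rewrite -ipZl -Px (eigen_selfadjoint norm_ip eB bP Pe) Pe ipZr.
  by move=> /(mulIf xk) ->; exact: lt_le_trans (mlam k).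
by rewrite /powR gt_eqF.
Qed.

End FunctionalCalculus.

(** * Powers of positive operators and the relative operator *)

Section PositiveOperators.
Variables (R : realType) (H : completeNormedModType R) (ip : {dot H for idfun}).
Hypothesis norm_ip : forall x : H, `|x| ^+ 2 = ip x x.
Implicit Types (x y z : H) (T S A B C P Q : H -> H) (e f : nat -> H).

Section Powers.
Variables (P : H -> H) (e : nat -> H) (lam : nat -> R) (m : R).
Hypotheses (eB : onb ip e) (bP : bounded_op P) (Pe : forall k, P (e k) = lam k *: e k)
  (m0 : 0 < m) (mlam : forall k, m <= lam k).

Let lam0 k : 0 < lam k. Proof. exact: lt_le_trans (mlam k). Qed.

Lemma onb_neq0 k : e k != 0.
Proof. by rewrite -normr_eq0 (onb_norm norm_ip eB) oner_eq0. Qed.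

Lemma op_pow_bounded s : bounded_op (op_pow ip P s).
Proof. by have [] := op_powP norm_ip s eB bP Pe m0 mlam. Qed.

Lemma op_pow_eigen s k : op_pow ip P s (e k) = (lam k `^ s) *: e k.
Proof.
by have [_ h] := op_powP norm_ip s eB bP Pe m0 mlam; apply: h; rewrite ?onb_neq0.
Qed.

Lemma op_pow_selfadjoint s x y : ip (op_pow ip P s x) y = ip x (op_pow ip P s y).
Proof.
exact: (eigen_selfadjoint norm_ip eB (op_pow_bounded s) (op_pow_eigen s)).
Qed.

Lemma op_pow_comp s t : op_pow ip P s \o op_pow ip P t = op_pow ip P (s + t).
Proof.
apply: (bounded_op_eq_onb norm_ip eB) => [||k].
- by apply: bounded_op_comp; exact: op_pow_bounded.
- exact: op_pow_bounded.
rewrite /= !op_pow_eigen (linear_propZ (op_pow_bounded s).1) op_pow_eigen scalerA.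
by rewrite [s + t]addrC powRD// (gt_eqF (lam0 k)) implybT.
Qed.

Lemma op_pow0 : op_pow ip P 0 = id.
Proof.
apply: (bounded_op_eq_onb norm_ip eB (op_pow_bounded 0) (@bounded_op_id _ _)) => k.
by rewrite op_pow_eigen powRr0 scale1r.
Qed.

Lemma op_pow1 : op_pow ip P 1 = P.
Proof.
apply: (bounded_op_eq_onb norm_ip eB (op_pow_bounded 1) bP) => k.
by rewrite op_pow_eigen powRr1 ?Pe// ltW.
Qed.

Lemma op_powNK s x : op_pow ip P (- s) (op_pow ip P s x) = x.
Proof.
by have := op_pow_comp (- s) s; rewrite addNr op_pow0 => /(congr1 (@^~ x)).
Qed.

Lemma op_powKN s x : op_pow ip P s (op_pow ip P (- s) x) = x.
Proof.
by have := op_pow_comp s (- s); rewrite addrN op_pow0 => /(congr1 (@^~ x)).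
Qed.

Lemma op_invE : op_inv P = op_pow ip P (- 1).
Proof.
apply/funext => y.
have PP : P (op_pow ip P (-1) y) = y by have := op_powKN 1 y; rewrite op_pow1.
have : P (op_inv P y) = y by exact: (@getI _ [set x | P x = y] _ PP).
by move=> Py; have := op_powNK 1 (op_inv P y); rewrite op_pow1 Py.
Qed.

End Powers.

Hypotheses (sepH : separable H) (infH : ~ finite_dim H).

Lemma PC2_spectral A g : PC2 ip A g -> exists e (lam : nat -> R) m,
  [/\ onb ip e, forall k, plusI A g (e k) = lam k *: e k,
    0 < m /\ (forall k, m <= lam k), 0 < g &
    cvgn (series (fun k => (lam k - g) ^+ 2))].
Proof.
move=> [hA sA [_ [m m0 mP]]].
have [e [l [eB Ae]]] := hs_spectral norm_ip sepH infH hA sA.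
have Pe k : plusI A g (e k) = (l k + g) *: e k by rewrite /plusI Ae scalerDl.
have ml k : m <= l k + g.
  have := mP (e k); rewrite Pe ipZr -norm_ip (onb_norm norm_ip eB).
  by rewrite expr1n !mulr1.
exists e, (fun k => l k + g), m; split => //.
(* The eigenvalues l_k of [A] tend to 0 while |l_k| + g stays at least [m], so g >= m. *)
- apply: (lt_le_trans m0).
  have c : `|A (e k)| + g @[k --> \oo] --> 0 + g.
    by apply: cvgD; [exact: hs_cvg0 norm_ip _ _ hA eB|exact: cvg_cst].
  rewrite -[X in _ <= X]add0r -(cvg_lim _ c)//; apply: limr_ge; first exact: cvgP c.
  apply: nearW => k; apply: le_trans (ml k) _.
  by rewrite Ae normrZ (onb_norm norm_ip eB) mulr1 lerD2r ler_norm.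
- have := hs_is_cvg norm_ip hA eB.
  suff -> : (fun k => `|A (e k)| ^+ 2) = (fun k => (l k + g - g) ^+ 2) by [].
  apply/funext => k; rewrite Ae normrZ (onb_norm norm_ip eB) mulr1.
  by rewrite real_normK ?num_real// addrK.
Qed.

Lemma PC2_bounded A g : PC2 ip A g -> bounded_op (plusI A g).
Proof. by case=> -[bA _] _ _; exact: bounded_op_plusI. Qed.

(** With C = (B + mu I)^(-1/2), subtracting g / mu leaves C A C + g ((B + mu I)^-1 - mu^-1 I), and
    the eigenvalues (mu - lam_k) / (lam_k mu) of the last operator are square summable. Positivity
    comes from |x| <= M |C x|, where M bounds (B + mu I)^(1/2). *)
Lemma rel_op_PC2 A g B mu : PC2 ip A g -> PC2 ip B mu ->
  PC2 ip (plusI (rel_op ip A g B mu) (- (g / mu))) (g / mu).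
Proof.
move=> hA hB; have bA := PC2_bounded hA; have bB := PC2_bounded hB.
have [e [lam [m [eB Be [m0 mlam] mu0 csq]]]] := PC2_spectral hB.
set P := plusI B mu in bB Be; set C := op_pow ip P (- 2^-1).
have bC : bounded_op C := op_pow_bounded eB bB Be m0 mlam _.
have sC : forall x y, ip (C x) y = ip x (C y).
  exact: (op_pow_selfadjoint eB bB Be m0 mlam).
have [hsA [_ sA] [[_ sAg] [mA mA0 posA]]] := hA.
have bL : bounded_op (rel_op ip A g B mu).
  by rewrite /rel_op; apply: bounded_op_comp => //; exact: bounded_op_comp.
have sL x y : ip (rel_op ip A g B mu x) y = ip x (rel_op ip A g B mu y).
  by rewrite /rel_op /= sC sAg sC.
have bD := bounded_op_plusI (- (g / mu)) bL.
split.
- have -> : plusI (rel_op ip A g B mu) (- (g / mu)) =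
      fun x => (C \o (A \o C)) x + g *: plusI (op_pow ip P (-1)) (- mu^-1) x.
    apply/funext => x.
    have CC : C (C x) = op_pow ip P (-1) x.
      have := op_pow_comp eB bB Be m0 mlam (- 2^-1) (- 2^-1).
      have -> : - 2^-1 - 2^-1 = -1 :> R by lra.
      by move=> /(congr1 (@^~ x)).
    rewrite /rel_op -/P -/C /plusI -CC /= (linear_propD bC.1) (linear_propZ bC.1).
    by rewrite scalerDr addrA scalerA mulrN.
  apply: (hsD norm_ip).
    by apply: (hs_compl norm_ip) => //; exact: hs_compr.
  apply: (hsZ norm_ip).
  have bI := op_pow_bounded eB bB Be m0 mlam (-1).
  apply: (@hsP _ _ _ _ e ((m * mu) ^- 2 * limn (series (fun k => (lam k - mu) ^+ 2)))) => //.
    exact: bounded_op_plusI.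
  move=> n; rewrite -(seriesE (fun k => `|plusI (op_pow ip P (-1)) (- mu^-1) (e k)| ^+ 2)).
  have le1 k : `|plusI (op_pow ip P (-1)) (- mu^-1) (e k)| ^+ 2 <=
      (m * mu) ^- 2 * (lam k - mu) ^+ 2.
    have l0 : 0 < lam k by exact: lt_le_trans (mlam k).
    rewrite /plusI (op_pow_eigen eB bB Be m0 mlam) -scalerDl normrZ (onb_norm norm_ip eB).
    rewrite mulr1 real_normK ?num_real// powR_inv1 ?(ltW l0)//.
    have -> : ((lam k)^-1 - mu^-1) ^+ 2 = (lam k * mu) ^- 2 * (lam k - mu) ^+ 2.
      by field; rewrite !gt_eqF.
    apply: ler_wpM2r; first exact: sqr_ge0.
    rewrite lef_pV2 ?posrE ?exprn_gt0 ?mulr_gt0//.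
    by apply: lerXn2r; rewrite ?nnegrE ?mulr_ge0 ?(ltW m0) ?(ltW l0) ?(ltW mu0)// ler_pM2r.
  apply: (@le_trans _ _ (\sum_(k < n) (m * mu) ^- 2 * (lam k - mu) ^+ 2)).
    by rewrite seriesE; exact: ler_sum.
  rewrite -mulr_sumr; apply: ler_wpM2l; first by rewrite invr_ge0 exprn_ge0// mulr_ge0// ltW.
  rewrite -(seriesE (fun k => (lam k - mu) ^+ 2)).
  by apply: nneg_series_le_lim csq => k; exact: sqr_ge0.
- split => // x y; rewrite /plusI ipDl ipDr sL ipZl ipZr.
  by [].
- rewrite plusINK; split; first by split.
  have bC' := op_pow_bounded eB bB Be m0 mlam (2^-1).
  have [M M0 CM] := bounded_op_le bC'.
  exists (mA / M ^+ 2); first by rewrite divr_gt0// exprn_gt0.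
  move=> x; have -> : ip x (rel_op ip A g B mu x) = ip (C x) (plusI A g (C x)).
    by rewrite /rel_op /= -sC.
  apply: le_trans (posA _); rewrite -mulrA; apply: ler_wpM2l; first exact: ltW.
  rewrite ler_pdivrMl ?exprn_gt0// -exprMn; apply: lerXn2r; rewrite ?nnegrE ?mulr_ge0 ?(ltW M0)//.
  by have := CM (C x); rewrite (op_powKN eB bB Be m0 mlam).
Qed.

End PositiveOperators.

(** * Determinants of operators similar to a diagonal one *)

Section ConjugateDiagonal.
Variables (R : realType) (H : completeNormedModType R) (ip : {dot H for idfun}).
Hypothesis norm_ip : forall x : H, `|x| ^+ 2 = ip x x.
Hypotheses (sepH : separable H) (infH : ~ finite_dim H).
Variables (C C' : H -> H) (f : nat -> H).
Hypotheses (bC : bounded_op C) (bC' : bounded_op C').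
Hypotheses (CK : cancel C C') (C'K : cancel C' C) (fB : onb ip f).

(** The vectors C f_j form a Riesz basis, which determines bounded operators just as an orthonormal
    basis does. *)
Lemma bounded_op_eq_conj S T : bounded_op S -> bounded_op T ->
  (forall j, S (C (f j)) = T (C (f j))) -> S = T.
Proof.
move=> bS bT ST; apply/funext => x; rewrite -(C'K x).
have : S \o C = T \o C.
  by apply: (bounded_op_eq_onb norm_ip fB) => //; exact: bounded_op_comp.
by move=> /(congr1 (@^~ (C' x))).
Qed.

Section Expansion.
Variables (K : H -> H) (d : nat -> R).
Hypotheses (bK : bounded_op K) (Kf : forall j, K (C (f j)) = d j *: C (f j)).
Hypothesis cd : cvgn (series (fun j => `|d j|)).

Let S := limn (series (fun j => `|d j|)).

Lemma abs_le_sum j : `|d j| <= S.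
Proof.
have := @nneg_series_le_lim _ (fun j => `|d j|) j.+1 (fun=> normr_ge0 _) cd.
apply: le_trans; rewrite seriesE big_ord_recr/= lerDr.
by apply: sumr_ge0.
Qed.

Lemma conj_diagE : exists D, [/\ bounded_op D, K = C \o (D \o C'),
  forall j, D (f j) = d j *: f j & forall x j, ip (D x) (f j) = d j * ip x (f j)].
Proof.
have [D [bD Df DE]] := diag_op norm_ip fB abs_le_sum.
exists D; split => //; apply: bounded_op_eq_conj => //.
  by apply: bounded_op_comp => //; exact: bounded_op_comp.
by move=> j; rewrite Kf /= CK Df (linear_propZ bC.1).
Qed.

Lemma conj_diag_hs : hilbert_schmidt ip K.
Proof.
have [D [bD -> Df _]] := conj_diagE.
apply: (hs_compl norm_ip) => //; apply: (hs_compr norm_ip) => //.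
apply: (@hsP _ _ _ _ f (S * S)) => // n.
have S0 : 0 <= S by apply: le_trans (abs_le_sum 0).
apply: (@le_trans _ _ (\sum_(k < n) S * `|d k|)).
  apply: ler_sum => k _; rewrite Df normrZ (onb_norm norm_ip fB) mulr1 expr2.
  by apply: ler_wpM2r => //; exact: abs_le_sum.
rewrite -mulr_sumr; apply: ler_wpM2l => //; rewrite -(seriesE (fun k => `|d k|)).
exact: (@nneg_series_le_lim _ (fun j => `|d j|) n (fun=> normr_ge0 _) cd).
Qed.

(* With [u j = C (f j)] and [v j = C^{-*} (f j)], [K = sum_j d j <., v j> u j]. *)
Lemma conj_diag_expansion : exists (u v : nat -> H) (c : R),
  [/\ forall j, `|u j| ^+ 2 <= c, forall j, `|v j| ^+ 2 <= c,
    forall j l, ip (v j) (u l) = (j == l)%:R &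
    forall x y, series (fun j => d j * ip x (v j) * ip y (u j)) @ \oo --> ip (K x) y].
Proof.
have [D [bD KE _ DE]] := conj_diagE.
have [Ca [bCa CCa]] := adjoint_exists norm_ip fB bC.
have [Ca' [bCa' CCa']] := adjoint_exists norm_ip fB bC'.
have [M1 M10 CM] := bounded_op_le bC; have [M2 M20 CM'] := bounded_op_le bCa'.
exists (fun j => C (f j)), (fun j => Ca' (f j)), (M1 ^+ 2 + M2 ^+ 2); split.
- move=> j; apply: (@le_trans _ _ (M1 ^+ 2)); last by rewrite lerDl sqr_ge0.
  apply: lerXn2r; rewrite ?nnegrE ?(ltW M10)//.
  by have := CM (f j); rewrite (onb_norm norm_ip fB) mulr1.
- move=> j; apply: (@le_trans _ _ (M2 ^+ 2)); last by rewrite lerDr sqr_ge0.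
  apply: lerXn2r; rewrite ?nnegrE ?(ltW M20)//.
  by have := CM' (f j); rewrite (onb_norm norm_ip fB) mulr1.
- by move=> j l; rewrite (adjoint_sym CCa') CK (onb_ip fB).
- move=> x y; rewrite KE /= CCa.
  apply: eq_cvgn (parseval norm_ip fB (D (C' x)) (Ca y)) => n.
  rewrite !seriesE; apply: eq_bigr => j _.
  by rewrite DE (adjoint_sym CCa) CCa'.
Qed.

(* The singular values of [K] are [<K g_k, h_k>], with [g] an eigenbasis of
   [K^* K] and [h] the normalized [K g_k], and these sum to at most
   [sum_j |d_j| |u_j| |v_j|] by Bessel. *)
Lemma conj_diag_trace_class : trace_class ip K.
Proof.
have [u [v [c [uc vc _ Kexp]]]] := conj_diag_expansion.
have [K' [bK' KK']] := adjoint_exists norm_ip fB bK.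
have hKK : hilbert_schmidt ip (K' \o K) by exact: hs_compl conj_diag_hs.
have sKK : selfadjoint ip (K' \o K).
  split; first exact: hKK.1.
  by move=> x y /=; rewrite (adjoint_sym KK') KK'.
have [g [kap [gB Kg]]] := hs_spectral norm_ip sepH infH hKK sKK.
pose sig k := `|K (g k)|.
have kapE k : kap k = sig k ^+ 2.
  rewrite /sig norm_ip KK'; have /= -> := Kg k.
  by rewrite ipZr (onb_ip1 gB) mulr1.
have [M M0 KM] := bounded_op_le bK.
have sigM k : `|sig k| <= M.
  by rewrite normr_id; have := KM (g k); rewrite (onb_norm norm_ip gB) mulr1.
have [T [bT Tg TE]] := diag_op norm_ip gB sigM.
split => //; exists T, g; split => //.
  split.
  - by split => //; exact: (eigen_selfadjoint norm_ip gB bT Tg).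
  - move=> x; have cx := parseval norm_ip gB x (T x).
    rewrite -(cvg_lim _ cx)//; apply: limr_ge; first exact: cvgP cx.
    apply: nearW => n; rewrite seriesE sumr_ge0// => k _.
    by rewrite TE mulrCA -expr2; apply: mulr_ge0; [exact: normr_ge0|exact: sqr_ge0].
  - move=> x y; rewrite KK'; congr (ip x _).
    have : T \o T = K' \o K.
      apply: (bounded_op_eq_onb norm_ip gB) => [||k]; first exact: bounded_op_comp.
        exact: hKK.1.
      by rewrite Kg kapE /= !(Tg, linear_propZ bT.1) scalerA -expr2.
    by move=> /(congr1 (@^~ y)).
have gT k : ip (g k) (T (g k)) = sig k by rewrite Tg ipZr (onb_ip1 gB) mulr1.
(* The inverse of 0 is 0, so [h k] is 0 when [K (g k)] is, and the identities below hold in that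
   case too. *)
pose h k := (sig k)^-1 *: K (g k).
have sig0 k : 0 <= sig k by exact: normr_ge0.
have Kgh k : ip (K (g k)) (h k) = sig k.
  rewrite /h ipZr -norm_ip -/(sig k) expr2 mulrA.
  by have [->|s0] := eqVneq (sig k) 0; rewrite ?mulr0// mulVf ?mul1r.
have h0 i j : i != j -> ip (h i) (h j) = 0.
  move=> ij; rewrite /h ipZl ipZr KK'; have /= -> := Kg j.
  by rewrite ipZr (onb_ortho gB ij) !mulr0.
have h1 i : ip (h i) (h i) <= 1.
  rewrite {1}/h ipZl Kgh.
  by have [->|s0] := eqVneq (sig i) 0; rewrite ?mulr0// mulVf.
apply: (@nneg_series_is_cvg _ _ (S * c)) => [k|n]; first by rewrite gT.
have c1 : \sum_(k < n) series (fun j => d j * ip (g k) (v j) * ip (h k) (u j)) m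
    @[m --> \oo] --> \sum_(k < n) ip (K (g k)) (h k).
  by apply: cvg_bigsum => k; exact: Kexp.
rewrite seriesE; under eq_bigr do rewrite gT -Kgh.
rewrite -(cvg_lim _ c1)//; apply: limr_le; first exact: cvgP c1.
apply: nearW => m; under eq_bigr do rewrite seriesE.
have c0 : 0 <= c by apply: le_trans (uc 0); exact: sqr_ge0.
apply: (@le_trans _ _ (\sum_(j < m) `|d j| * c)); last first.
  rewrite -mulr_suml; apply: ler_wpM2r => //; rewrite -(seriesE (fun k => `|d k|)).
  exact: (@nneg_series_le_lim _ (fun j => `|d j|) m (fun=> normr_ge0 _) cd).
rewrite exchange_big/=; apply: ler_sum => j _.
under eq_bigr do rewrite -mulrA.
rewrite -mulr_sumr; apply: le_trans (ler_norm _) _; rewrite normrM.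
apply: ler_wpM2l => //; apply: le_trans (ler_norm_sum _ _ _) _.
(* By a b <= (a^2 + b^2) / 2, followed by Bessel for [v j] along [g] and for [u j] along [h], each
   at most [c]. *)
apply: (@le_trans _ _ (\sum_(k < n) (2^-1 * ip (v j) (g k) ^+ 2 + 2^-1 * ip (u j) (h k) ^+ 2))).
  apply: ler_sum => k _; rewrite (ipC ip (g k)) (ipC ip (h k)) normrM.
  rewrite -[ip (v j) _ ^+ 2]real_normK ?num_real// -[ip (u j) _ ^+ 2]real_normK ?num_real//.
  set a := `|_|; set b := `|_|.
  have : 0 <= (a - b) ^+ 2 by exact: sqr_ge0.
  rewrite sqrrB; lra.
rewrite big_split/= -!mulr_sumr.
have := le_trans (onb_bessel norm_ip gB (v j) n) (vc j).
have := le_trans (bessel norm_ip (u j) n h0 h1) (uc j).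
lra.
Qed.

(** In the fixed basis b_i the matrix of [K] is X diag(d) Y with X i j = <b_i, u_j> and Y j i =
    <v_j, b_i>. Parseval turns the biorthogonality of u and v into Y X = I, and Bessel bounds its
    partial sums by [c]. *)
Lemma conj_diag_fredholm (P : R) :
  \prod_(j < n) (1 + d j) @[n --> \oo] --> P -> fredholm_det ip K = P.
Proof.
move=> cP; have bB : onb ip (Defs.basis ip) by apply: (getI fB).
have [u [v [c [uc vc uv Kexp]]]] := conj_diag_expansion.
have WE N j l : `|\sum_(i < N) ip (v j) (Defs.basis ip i) * ip (Defs.basis ip i) (u l)| <= c.
  apply: le_trans (ler_norm_sum _ _ _) _.
  apply: (@le_trans _ _ (\sum_(i < N) (2^-1 * ip (v j) (Defs.basis ip i) ^+ 2 +
      2^-1 * ip (u l) (Defs.basis ip i) ^+ 2))).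
    apply: ler_sum => k _; rewrite (ipC ip (Defs.basis ip k)) normrM.
    rewrite -[ip (v j) _ ^+ 2]real_normK ?num_real// -[ip (u l) _ ^+ 2]real_normK ?num_real//.
    set a := `|_|; set b := `|_|.
    have : 0 <= (a - b) ^+ 2 by exact: sqr_ge0.
    rewrite sqrrB; lra.
  rewrite big_split/= -!mulr_sumr.
  have := le_trans (onb_bessel norm_ip bB (v j) N) (vc j).
  have := le_trans (onb_bessel norm_ip bB (u l) N) (uc l).
  lra.
apply: (@lim_minor_series _ (fun i j => ip (Defs.basis ip i) (u j))
  (fun j i => ip (v j) (Defs.basis ip i)) d c
  (fun i i' => ip (Defs.basis ip i) (K (Defs.basis ip i')))) => //.
- move=> j l; rewrite /delta -uv.
  apply: eq_cvgn (parseval norm_ip bB (v j) (u l)) => n.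
  by rewrite seriesE; apply: eq_bigr => i _; rewrite (ipC ip (u l)).
- move=> i i'; rewrite ipC; apply: eq_cvgn (Kexp (Defs.basis ip i') (Defs.basis ip i)) => n.
  rewrite seriesE; apply: eq_bigr => j _.
  by rewrite (ipC ip (v j)) mulrC.
Qed.

End Expansion.
End ConjugateDiagonal.

Lemma abs_expR_sub1 (R : realType) (w : R) : `|expR w - 1| <= `|w| * expR `|w|.
Proof.
have e0 : 0 < expR w by exact: expR_gt0.
have h1 := expR_ge1Dx w; have h2 := expR_ge1Dx (- w).
have [w0|w0] := leP 0 w.
  rewrite ger0_norm; last lra.
  rewrite ger0_norm//.
  have ee : expR w * expR (- w) = 1 by rewrite expRN mulfV// gt_eqF.
  have : expR w * (1 - w) <= expR w * expR (- w) by rewrite ler_pM2l//; lra.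
  rewrite ee; lra.
have ew : expR w <= 1 by rewrite -expR0 ler_expR ltW.
rewrite ler0_norm; last lra.
rewrite ltr0_norm//.
have e1 : 1 <= expR (- w) by rewrite -expR0 ler_expR; lra.
nra.
Qed.

(** * Scalar parts and the extended determinants *)

Section ExtendedDeterminants.
Variables (R : realType) (H : completeNormedModType R) (ip : {dot H for idfun}).
Hypothesis norm_ip : forall x : H, `|x| ^+ 2 = ip x x.
Hypotheses (sepH : separable H) (infH : ~ finite_dim H).

(** With S = |A| and z = S e_k, Cauchy-Schwarz for the form of S gives |z|^4 <= <z, S z> <e_k, z> <=
    M |z|^2 <e_k, z>, hence |A e_k|^2 <= M <e_k, S e_k>. Uniqueness of the scalar part thus passes
    to the trace class. *)
Lemma trace_class_hs A : trace_class ip A -> hilbert_schmidt ip A.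
Proof.
move=> [bA [S [e [[[bS sS] S0 SA] eB cS]]]].
have [M M0 SM] := bounded_op_le bS.
apply: (@hsP _ _ _ _ e (M * limn (series (fun k => ip (e k) (S (e k)))))) => // n.
apply: (@le_trans _ _ (\sum_(k < n) M * ip (e k) (S (e k)))); last first.
  rewrite -mulr_sumr; apply: ler_wpM2l; first exact: ltW.
  rewrite -(seriesE (fun k => ip (e k) (S (e k)))).
  exact: nneg_series_le_lim.
apply: ler_sum => k _; rewrite norm_ip -SA -sS -norm_ip.
set z := S (e k).
have h : (`|z| ^+ 2) ^+ 2 <= M * `|z| ^+ 2 * ip (e k) z.
  have := psd_cauchy_schwarz z (e k) bS.1 sS S0.
  rewrite -/z -norm_ip => /le_trans; apply; apply: ler_wpM2r => //.
  apply: le_trans (ler_norm _) _; apply: le_trans (cauchy_schwarz norm_ip _ _) _.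
  by rewrite expr2 mulrA [M * _]mulrC -mulrA; apply: ler_wpM2l.
have [z0|z0] := eqVneq `|z| 0.
  by rewrite z0 expr0n/= mulr_ge0// ltW.
have zp : 0 < `|z| ^+ 2 by rewrite exprn_gt0// lt_def z0 normr_ge0.
by move: h; rewrite expr2 [M * _ * _]mulrAC ler_pM2r.
Qed.

Lemma scalar_part_hsE T g : hilbert_schmidt ip (plusI T (- g)) ->
  scalar_part (hilbert_schmidt ip) T = g.
Proof.
move=> hT; apply: oppr_inj; apply: (hs_scalar_uniq norm_ip _ hT).
exact: (@getI _ [set g | hilbert_schmidt ip (plusI T (- g))] _ hT).
Qed.

Lemma scalar_part_trE T g : trace_class ip (plusI T (- g)) ->
  scalar_part (trace_class ip) T = g.
Proof.
move=> hT; apply: oppr_inj.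
apply: (hs_scalar_uniq norm_ip _ (trace_class_hs hT)); apply: trace_class_hs.
exact: (@getI _ [set g | trace_class ip (plusI T (- g))] _ hT).
Qed.

Section Conjugate.
Variables (C C' : H -> H) (f : nat -> H).
Hypotheses (bC : bounded_op C) (bC' : bounded_op C').
Hypotheses (CK : cancel C C') (C'K : cancel C' C) (fB : onb ip f).

(** The estimate |exp w - 1| <= |w| exp |w| makes T - g trace class, which identifies [g] as the
    scalar part; the Fredholm product is then that of the exp w_j. *)
Lemma detX_conj T g (w : nat -> R) : bounded_op T -> 0 < g ->
  (forall j, T (C (f j)) = (g * expR (w j)) *: C (f j)) ->
  cvgn (series (fun j => `|w j|)) ->
  detX ip T = g * expR (limn (series w)).
Proof.
move=> bT g0 Tf cw.
pose S := limn (series (fun j => `|w j|)).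
have wS j : `|w j| <= S.
  have := @nneg_series_le_lim _ (fun j => `|w j|) j.+1 (fun=> normr_ge0 _) cw.
  apply: le_trans; rewrite seriesE big_ord_recr/= lerDr.
  by apply: sumr_ge0.
have cd : cvgn (series (fun j => `|expR (w j) - 1|)).
  have c1 : cvgn (series (fun j => expR S * `|w j|)) by exact: is_cvg_seriesZ.
  apply: (le_norm_series_is_cvg _ c1) => j.
  rewrite normr_id; apply: le_trans (abs_expR_sub1 _) _.
  by rewrite mulrC; apply: ler_wpM2r => //; rewrite ler_expR.
have Kf j : plusI T (- g) (C (f j)) = (g * (expR (w j) - 1)) *: C (f j).
  by rewrite /plusI Tf -scalerDl mulrBr mulr1.
have bK := bounded_op_plusI (- g) bT.
have tK : trace_class ip (plusI T (- g)).
  apply: (conj_diag_trace_class norm_ip sepH infH bC bC' CK C'K fB bK Kf).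
  have c1 : cvgn (series (fun j => `|g| * `|expR (w j) - 1|)) by exact: is_cvg_seriesZ.
  by move: c1; congr (cvgn (series _)); apply/funext => j; rewrite normrM.
rewrite /detX (scalar_part_trE tK); congr (_ * _).
apply: (conj_diag_fredholm norm_ip bC bC' CK C'K fB (d := fun j => expR (w j) - 1)) => //.
- exact: bounded_opZ.
- by move=> j; rewrite Kf scalerA mulrA mulVf ?mul1r// gt_eqF.
- have c1 : cvgn (series w) by apply: normed_cvg.
  by apply: eq_cvgn (cvg_prod_expR c1) => n; apply: eq_bigr => j _; rewrite addrC subrK.
Qed.

(** The Carleman factor multiplies the eigenvalue g exp t_j by exp (- (exp t_j - 1)). The new
    exponents are of order t_j^2 for small t_j, hence summable in cases where the t_j are not. *)
Lemma det2X_conj T g (t : nat -> R) : bounded_op T -> 0 < g ->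
  (forall j, T (C (f j)) = (g * expR (t j)) *: C (f j)) ->
  hilbert_schmidt ip (plusI T (- g)) ->
  cvgn (series (fun j => `|t j - (expR (t j) - 1)|)) ->
  det2X ip T = g * expR (limn (series (fun j => t j - (expR (t j) - 1)))).
Proof.
move=> bT g0 Tf hT ct; rewrite /det2X (scalar_part_hsE hT).
have bA := bounded_op_plusI (- g) bT.
have bE : bounded_op (fun x => - (g^-1 *: plusI T (- g) x)).
  have -> : (fun x => - (g^-1 *: plusI T (- g) x)) =
      (fun x => -1 *: (g^-1 *: plusI T (- g) x)).
    by apply/funext => x; rewrite scaleN1r.
  by do 2 apply: bounded_opZ.
apply: detX_conj => // [|j].
  by apply: bounded_op_comp => //; exact: op_exp_bounded.
have -> : g * expR (t j - (expR (t j) - 1)) = expR (- (expR (t j) - 1)) * (g * expR (t j)).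
  by rewrite expRD; ring.
rewrite /= (op_exp_eigen (t := - (expR (t j) - 1)))//.
  by rewrite (linear_propZ bT.1) Tf scalerA.
rewrite /plusI Tf -scalerDl scalerA -scaleNr; congr (_ *: _).
by field; rewrite gt_eqF.
Qed.

End Conjugate.

Lemma PC2_op_pow_eigen A g s l x : PC2 ip A g -> plusI A g x = l *: x -> x != 0 ->
  op_pow ip (plusI A g) s x = (l `^ s) *: x.
Proof.
move=> hA; have bA := PC2_bounded hA.
have [e [lam [m [eB Ae [m0 mlam] _ _]]]] := PC2_spectral norm_ip sepH infH hA.
by have [_ h] := op_powP norm_ip s eB bA Ae m0 mlam; exact: h.
Qed.

Lemma PC2_op_pow_bounded A g s : PC2 ip A g -> bounded_op (op_pow ip (plusI A g) s).
Proof.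
move=> hA; have bA := PC2_bounded hA.
have [e [lam [m [eB Ae [m0 mlam] _ _]]]] := PC2_spectral norm_ip sepH infH hA.
by have [] := op_powP norm_ip s eB bA Ae m0 mlam.
Qed.

(** Independence of the representation: if C P C' = C1 P1 C1', then C1' C sends an eigenvector of P
    to an eigenvector of P1 for the same eigenvalue, so both candidates agree on the C e_j. *)
Lemma sim_powE C C' A g s : bounded_op C -> bounded_op C' -> cancel C C' ->
  cancel C' C -> PC2 ip A g ->
  sim_pow ip (C \o plusI A g \o C') s = C \o op_pow ip (plusI A g) s \o C'.
Proof.
move=> bC bC' CK C'K hA; have bA := PC2_bounded hA.
have := @getI _ [set Q | exists C1 C1' A1 g1,
    [/\ bounded_op C1 /\ bounded_op C1', cancel C1 C1' /\ cancel C1' C1, PC2 ip A1 g1,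
        C \o plusI A g \o C' = C1 \o plusI A1 g1 \o C1' &
        Q = C1 \o op_pow ip (plusI A1 g1) s \o C1']].
move=> /(_ (C \o op_pow ip (plusI A g) s \o C')) [|].
  by exists C, C', A, g.
move=> C1 [C1' [A1 [g1 [[bC1 bC1'] [C1K C1'K] hA1 TE QE]]]].
rewrite /sim_pow QE.
have [e [lam [m [eB Ae [m0 mlam] _ _]]]] := PC2_spectral norm_ip sepH infH hA.
have b1 := PC2_op_pow_bounded s hA; have b2 := PC2_op_pow_bounded s hA1.
apply: (bounded_op_eq_conj norm_ip bC C'K eB) => [||j].
- by apply: bounded_op_comp => //; exact: bounded_op_comp.
- by apply: bounded_op_comp => //; exact: bounded_op_comp.
rewrite /= CK (PC2_op_pow_eigen s hA (Ae j)) ?(onb_neq0 norm_ip eB)//.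
rewrite (linear_propZ bC.1).
rewrite (PC2_op_pow_eigen (l := lam j) s hA1).
- by rewrite (linear_propZ bC1.1) C1'K.
- have := congr1 (@^~ (C (e j))) TE; rewrite /= CK Ae (linear_propZ bC.1).
  by move=> /(congr1 C1'); rewrite C1K (linear_propZ bC1'.1).
- apply/eqP => /(congr1 C1); rewrite C1'K (linear_prop0 bC1.1) => /(congr1 C').
  rewrite CK (linear_prop0 bC'.1) => ej; have := onb_neq0 norm_ip eB j.
  by rewrite ej eqxx.
Qed.

End ExtendedDeterminants.

(** * Scalar estimates *)

Section Scalar.
Variable R : realType.
Implicit Types (x y t del nu : R).

Definition exp_rem y : R := expR y - 1 - y.

Lemma exp_rem_ge0 y : 0 <= exp_rem y.
Proof. by have := expR_ge1Dx y; rewrite /exp_rem; lra. Qed.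

Lemma expR_tangent a x : expR a * (1 + (x - a)) <= expR x.
Proof.
have -> : expR x = expR a * expR (x - a) by rewrite -expRD addrC subrK.
by rewrite ler_pM2l ?expR_gt0// expR_ge1Dx.
Qed.

(** The tangent at [y], evaluated at 0, gives exp_rem y <= y (exp y - 1). The square on the right is
    what lets square summable t_j suffice. *)
Lemma exp_rem_le y : exp_rem y <= y ^+ 2 * expR `|y|.
Proof.
have h1 : exp_rem y <= y * (expR y - 1).
  by have := expR_tangent y 0; rewrite expR0 /exp_rem; lra.
apply: le_trans h1 _; apply: le_trans (ler_norm _) _; rewrite normrM.
rewrite -[y ^+ 2]real_normK ?num_real// expr2 -mulrA.
by apply: ler_wpM2l => //; exact: abs_expR_sub1.
Qed.

(* [w_j] is [log_mix delta (r t_j)]. *)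
Definition log_mix del y : R := ln (1 + del * (expR y - 1)) - del * y.

Section Weight.
Variables (del y : R).
Hypotheses (del0 : 0 <= del) (del1 : del <= 1).

(** Jensen's inequality for exp at [y] and 0 with weights [del] and 1 - [del], read off the tangent
    at the mean. *)
Let mix_ge : expR (del * y) <= 1 + del * (expR y - 1).
Proof.
have h1 := expR_tangent (del * y) y; have := expR_tangent (del * y) 0; rewrite expR0 => h0.
have h2 := ler_wpM2l del0 h1.
have h3 : (1 - del) * (expR (del * y) * (1 + (0 - del * y))) <= (1 - del) * 1.
  by apply: ler_wpM2l => //; rewrite subr_ge0.
have -> : expR (del * y) = del * (expR (del * y) * (1 + (y - del * y))) +
    (1 - del) * (expR (del * y) * (1 + (0 - del * y))) by ring.
lra.
Qed.

Let mix_gt0 : 0 < 1 + del * (expR y - 1).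
Proof. exact: lt_le_trans (expR_gt0 _) mix_ge. Qed.

Lemma log_mix_ge0 : 0 <= log_mix del y.
Proof.
by rewrite /log_mix subr_ge0 -[X in X <= _]expRK ler_ln ?posrE ?expR_gt0.
Qed.

Lemma log_mix_le : log_mix del y <= del * exp_rem y.
Proof.
have : ln (1 + del * (expR y - 1)) <= del * (expR y - 1).
  by apply: le_ln1Dx; have := mix_gt0; lra.
by rewrite /log_mix /exp_rem; lra.
Qed.

Lemma expR_log_mix : expR (log_mix del y) =
  del * expR (y * (1 - del)) + (1 - del) * expR (- (y * del)).
Proof.
rewrite /log_mix expRD lnK ?posrE//.
have -> : y * (1 - del) = y + - (del * y) by ring.
by rewrite expRD [y * del]mulrC; ring.
Qed.

End Weight.

(** The inequality ln (1 + u) <= u, used at p = 1 + x a(x) and at 1 / p, squeezes the quotient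
    between a(x) / p and a(x). *)
Lemma ln1_ratio_cvg (a : R -> R) (a0 : R) : a x @[x --> 0^'+] --> a0 ->
  ln (1 + x * a x) / x @[x --> 0^'+] --> a0.
Proof.
move=> ca.
have cx : x @[x --> 0^'+] --> (0 : R) by apply: cvg_at_right_filter; exact: cvg_id.
have cd : 1 + x * a x @[x --> 0^'+] --> (1 : R).
  rewrite -[X in _ --> X]addr0 -[X in 1 + X](mul0r a0).
  by apply: cvgD; [exact: cvg_cst|exact: cvgM].
have cl : a x / (1 + x * a x) @[x --> 0^'+] --> a0.
  rewrite -[X in _ --> X]divr1.
  by apply: cvgM => //; apply: cvgV => //; rewrite oner_eq0.
apply: (squeeze_cvgr _ cl ca).
near=> x.
have x0 : 0 < x by near: x; exact: nbhs_right_gt.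
have p0 : 0 < 1 + x * a x by near: x; apply: (cvgr_gt 1).
set p := 1 + x * a x in p0 *.
have pE : x * a x = p - 1 by rewrite /p; ring.
apply/andP; split; last first.
  rewrite ler_pdivrMr// [a x * x]mulrC; apply: le_ln1Dx.
  by rewrite pE; lra.
have h : ln (1 + (p^-1 - 1)) <= p^-1 - 1.
  apply: le_ln1Dx; have : 0 < p^-1 by rewrite invr_gt0.
  lra.
move: h; have -> : 1 + (p^-1 - 1) = p^-1 by ring.
rewrite lnV ?posrE// => h.
rewrite ler_pdivlMr// mulrAC [a x * x]mulrC pE mulrBl mulfV ?gt_eqF// mul1r; lra.
Unshelve. all: by end_near. Qed.

Lemma abs_ln_le x p : 0 < p -> p <= x -> `|ln x| <= `|x - 1| * (1 + p^-1).
Proof.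
move=> p0 px; have x0 : 0 < x by exact: lt_le_trans px.
have ip0 : 0 < p^-1 by rewrite invr_gt0.
have h1 : ln x <= x - 1 by rewrite -{1}(addrNK 1 x) addrC; apply: le_ln1Dx; lra.
have h2 : - ln x <= x^-1 - 1.
  rewrite -lnV ?posrE//; rewrite -{1}(addrNK 1 x^-1) addrC; apply: le_ln1Dx.
  by have : 0 < x^-1 by [rewrite invr_gt0]; lra.
have h3 : x^-1 - 1 <= `|x - 1| * p^-1.
  have -> : x^-1 - 1 = (1 - x) * x^-1 by rewrite mulrBl mul1r mulfV ?gt_eqF.
  apply: le_trans (ler_norm _) _; rewrite normrM distrC; apply: ler_wpM2l => //.
  by rewrite gtr0_norm ?invr_gt0// lef_pV2 ?posrE.
have h4 := ler_norm (x - 1); have h5 : 0 <= `|x - 1| by [].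
have h6 : 0 <= `|x - 1| * p^-1 by rewrite mulr_ge0// ltW.
by rewrite ler_norml mulrDr mulr1; apply/andP; split; lra.
Qed.

End Scalar.

(** * The divergence *)

Lemma sq_series_bounded (R : realType) (t : nat -> R) :
  cvgn (series (fun j => t j ^+ 2)) -> exists2 M, 0 <= M & forall j, `|t j| <= M.
Proof.
move=> ct; pose S := limn (series (fun j => t j ^+ 2)).
have le_S j : t j ^+ 2 <= S.
  have := @nneg_series_le_lim _ _ j.+1 (fun k => sqr_ge0 (t k)) ct.
  apply: le_trans; rewrite seriesE big_ord_recr/= lerDr.
  by apply: sumr_ge0 => k _; exact: sqr_ge0.
have S0 : 0 <= S by apply: le_trans (le_S 0); exact: sqr_ge0.
exists (1 + S); first by rewrite addr_ge0.
move=> j; have := le_S j; rewrite -[t j ^+ 2]real_normK ?num_real//.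
have := sqr_ge0 (`|t j| - 1); rewrite sqrrB1; have := normr_ge0 (t j); lra.
Qed.

Lemma exp_rem_mul_le (R : realType) (r t M : R) : `|t| <= M ->
  exp_rem (r * t) <= r ^+ 2 * expR (`|r| * M) * t ^+ 2.
Proof.
move=> tM; apply: le_trans (exp_rem_le _) _; rewrite [leRHS]mulrAC -exprMn.
apply: ler_wpM2l; first exact: sqr_ge0.
by rewrite ler_expR normrM; apply: ler_wpM2l.
Qed.

Section Divergence.
Variables (R : realType) (H : completeNormedModType R) (ip : {dot H for idfun}).
Hypothesis norm_ip : forall x : H, `|x| ^+ 2 = ip x x.
Hypotheses (sepH : separable H) (infH : ~ finite_dim H).

(** The quotients lam_k / g stay above m / g > 0, where |ln x| is at most a constant times |x - 1|;
    square summability thus passes to the logarithms. *)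
Lemma PC2_log_spectral A g : PC2 ip A g -> 0 < g /\ exists e (t : nat -> R),
  [/\ onb ip e, forall k, plusI A g (e k) = (g * expR (t k)) *: e k &
    cvgn (series (fun k => t k ^+ 2))].
Proof.
move=> hA.
have [e [lam [m [eB Ae [m0 mlam] g0 csq]]]] := PC2_spectral norm_ip sepH infH hA.
split => //; exists e, (fun k => ln (lam k / g)); split => // [k|].
  have l0 : 0 < lam k by exact: lt_le_trans (mlam k).
  by rewrite lnK ?posrE ?divr_gt0// Ae mulrCA mulfV ?mulr1// gt_eqF.
have p0 : 0 < m / g by rewrite divr_gt0.
set c := (1 + (m / g)^-1) / g.
have c1 : cvgn (series (fun k => c ^+ 2 * (lam k - g) ^+ 2)) by exact: is_cvg_seriesZ.
apply: (le_norm_series_is_cvg _ c1) => k.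
have le1 : `|ln (lam k / g)| <= `|lam k / g - 1| * (1 + (m / g)^-1).
  by apply: abs_ln_le => //; rewrite ler_pM2r ?invr_gt0.
have c0 : 0 <= 1 + (m / g)^-1 by rewrite addr_ge0// invr_ge0 ltW.
have -> : c ^+ 2 * (lam k - g) ^+ 2 = (`|lam k / g - 1| * (1 + (m / g)^-1)) ^+ 2.
  rewrite [in RHS]exprMn real_normK ?num_real// /c.
  by move: (1 + _) => z; field; rewrite gt_eqF.
by rewrite normrX; apply: lerXn2r; rewrite ?nnegrE// mulr_ge0.
Qed.

Variables (A B : H -> H) (gam mu beta : R).
Hypotheses (gam0 : 0 < gam) (mu0 : 0 < mu) (beta0 : 0 < beta).
Let nu := gam / mu.

Let nu0 : 0 < nu. Proof. by rewrite divr_gt0. Qed.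

Variables (e : nat -> H) (t : nat -> R).
Hypotheses (hL : PC2 ip (plusI (rel_op ip A gam B mu) (- nu)) nu).
Hypotheses (eB : onb ip e).
Hypothesis Le : forall k, rel_op ip A gam B mu (e k) = (nu * expR (t k)) *: e k.
Hypothesis ct : cvgn (series (fun k => t k ^+ 2)).

(* [alpha * weight alpha r] is the delta of [logdet_div]. *)
Definition weight (alpha r : R) : R := nu `^ r / (alpha * nu `^ r + beta).

Lemma weight_mix alpha r : 0 < alpha ->
  0 < weight alpha r /\ alpha * weight alpha r <= 1.
Proof.
move=> a0; have n0 : 0 < nu `^ r by exact: powR_gt0.
have an0 : 0 < alpha * nu `^ r by rewrite mulr_gt0.
rewrite /weight; split; first by rewrite divr_gt0// addr_gt0.
by rewrite mulrA ler_pdivrMr ?addr_gt0// mul1r lerDl ltW.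
Qed.

(** Since delta = alpha * [weight], the bound delta * exp_rem on log_mix loses its alpha after
    division: the majorant survives alpha --> 0. *)
Lemma log_mix_series_le alpha r M j : 0 < alpha -> (forall j, `|t j| <= M) ->
  `|alpha^-1 * log_mix (alpha * weight alpha r) (r * t j)| <=
  weight alpha r * r ^+ 2 * expR (`|r| * M) * t j ^+ 2.
Proof.
move=> a0 tM; have [w0 w1] := weight_mix r a0.
have aw0 : 0 <= alpha * weight alpha r by rewrite mulr_ge0// ltW.
have ia0 : 0 <= alpha^-1 by rewrite invr_ge0 ltW.
move: (weight alpha r) w0 w1 aw0 => w w0 w1 aw0.
rewrite ger0_norm; last by rewrite mulr_ge0// log_mix_ge0.
apply: (@le_trans _ _ (alpha^-1 * (alpha * w * exp_rem (r * t j)))).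
  by apply: ler_wpM2l => //; exact: log_mix_le.
have -> : alpha^-1 * (alpha * w * exp_rem (r * t j)) = w * exp_rem (r * t j).
  by field; rewrite gt_eqF.
have -> : w * r ^+ 2 * expR (`|r| * M) * t j ^+ 2 = w * (r ^+ 2 * expR (`|r| * M) * t j ^+ 2).
  by ring.
by apply: ler_wpM2l; [exact: ltW|exact: exp_rem_mul_le].
Qed.

(** The exponent r delta of the prefactor cancels the power of nu in the scalar part, and the two ln
    beta cancel; every remaining term, already divided by alpha, has a limit. *)
Lemma logdet_divE alpha r : 0 < alpha ->
  logdet_div ip alpha beta r A gam B mu =
  beta^-1 * (- (r / (alpha + beta)) * ln nu +
    ln (1 + alpha * (nu `^ r / beta)) / alpha - ln (1 + alpha * beta^-1) / alpha +
    limn (series (fun j => alpha^-1 * log_mix (alpha * weight alpha r) (r * t j)))).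
Proof.
move=> a0; have [M M0 tM] := sq_series_bounded ct.
have n0 : 0 < nu `^ r by exact: powR_gt0.
have ab0 : 0 < alpha + beta by rewrite addr_gt0.
have anb0 : 0 < alpha * nu `^ r + beta by rewrite addr_gt0// mulr_gt0.
have [w0 w1] := weight_mix r a0.
set del := alpha * weight alpha r in w1 *.
have del0 : 0 <= del by rewrite mulr_ge0// ltW.
have delE : alpha * gam `^ r / (alpha * gam `^ r + beta * mu `^ r) = del.
  have -> : gam `^ r = nu `^ r * mu `^ r.
    by rewrite -powRM ?ltW// /nu divfK// gt_eqF.
  have m0 : 0 < mu `^ r by exact: powR_gt0.
  rewrite /del /weight; move: (nu `^ r) (mu `^ r) n0 m0 anb0 => x y x0 y0 xy0.
  field; rewrite !gt_eqF//; last by rewrite addr_gt0// !mulr_gt0.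
rewrite /logdet_div delE -/nu.
set L := rel_op ip A gam B mu.
have bP s : bounded_op (op_pow ip L s).
  by have := PC2_op_pow_bounded norm_ip sepH infH s hL; rewrite plusINK.
have Pe s j : op_pow ip L s (e j) = (nu `^ s * expR (t j * s)) *: e j.
  have := PC2_op_pow_eigen norm_ip sepH infH (l := nu * expR (t j)) (x := e j) s hL.
  rewrite plusINK => -> //; last exact: (onb_neq0 norm_ip eB).
  by rewrite powRM ?ltW ?expR_gt0// -expRM.
(* The scalar part: the value of the eigenvalue formula at t = 0. Its two summands are in proportion
   delta to 1 - delta. *)
set h := nu `^ (- (r * del)) * (alpha * nu `^ r + beta) / (alpha + beta).
have h0 : 0 < h by rewrite divr_gt0// mulr_gt0// powR_gt0.
have cw : cvgn (series (fun j => `|log_mix del (r * t j)|)).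
  set c := alpha * (weight alpha r * r ^+ 2 * expR (`|r| * M)).
  have c1 : cvgn (series (fun j => c * t j ^+ 2)) by exact: is_cvg_seriesZ.
  apply: (le_norm_series_is_cvg _ c1) => j; rewrite normr_id.
  have := log_mix_series_le r j a0 tM; rewrite -/del normrM gtr0_norm ?invr_gt0//.
  by rewrite ler_pdivrMl// /c !mulrA.
(* The eigenvectors of [L] are orthonormal, so the similarity is the identity here. *)
rewrite (detX_conj norm_ip sepH infH (@bounded_op_id _ _) (@bounded_op_id _ _)
  (C := id) (C' := id) (fun=> erefl) (fun=> erefl) eB (g := h) (w := fun j => log_mix del (r * t j)))//; first last.
- move=> j; rewrite /= !Pe !scalerA -scalerDl scalerA; congr (_ *: _).
  rewrite expR_log_mix//.
  have -> : nu `^ (r * (1 - del)) = nu `^ r * nu `^ (- (r * del)).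
    have -> : r * (1 - del) = r + - (r * del) by ring.
    by rewrite powRD// (gt_eqF nu0) implybT.
  have -> : t j * (r * (1 - del)) = r * t j * (1 - del) by ring.
  have -> : t j * - (r * del) = - (r * t j * del) by ring.
  rewrite /h; set E1 := expR _; set E2 := expR _; set p := nu `^ (- _).
  rewrite /del /weight; move: (nu `^ r) n0 anb0 => x x0 xb0.
  by field; rewrite !gt_eqF.
- apply: bounded_opZ; apply: bounded_opD; exact: bounded_opZ.
have pn s : 0 < nu `^ s by exact: powR_gt0.
rewrite lnM ?posrE ?pn ?(mulr_gt0 h0 (expR_gt0 _))//.
rewrite [ln (h * _)]lnM ?posrE ?expR_gt0// expRK ln_powR.
rewrite /h lnM ?posrE ?invr_gt0 ?(mulr_gt0 (pn _) anb0)//.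
rewrite lnM ?posrE ?pn// lnV ?posrE// ln_powR.
have -> : alpha * nu `^ r + beta = beta * (1 + alpha * (nu `^ r / beta)).
  by field; rewrite gt_eqF.
have e1 : alpha + beta = beta * (1 + alpha * beta^-1) by field; rewrite gt_eqF.
have -> : ln (alpha + beta) = ln beta + ln (1 + alpha * beta^-1).
  rewrite {1}e1 lnM ?posrE// addr_gt0// mulr_gt0// invr_gt0.
  by [].
rewrite lnM ?posrE//; last by rewrite addr_gt0// mulr_gt0// divr_gt0.
have -> : limn (series (fun j => alpha^-1 * log_mix del (r * t j))) =
    alpha^-1 * limn (series (fun j => log_mix del (r * t j))).
  apply: (@lim_seriesZ _ (fun j => log_mix del (r * t j)) alpha^-1).
  exact: normed_cvg.
move: (limn _) (ln nu) (ln beta) (ln _) (ln _) => W lnu lb x y.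
by field; rewrite !gt_eqF.
Qed.

Lemma cvg_weight (r : R -> R) (r0 : R) : r x @[x --> 0^'+] --> r0 ->
  nu `^ (r x) @[x --> 0^'+] --> nu `^ r0 /\
  weight x (r x) @[x --> 0^'+] --> nu `^ r0 / beta.
Proof.
move=> cr.
have cn : nu `^ (r x) @[x --> 0^'+] --> nu `^ r0.
  rewrite /powR gt_eqF//.
  apply: (@continuous_cvg _ _ _ _ _ _ (@expR R)); first exact: continuous_expR.
  by apply: cvgM => //; exact: cvg_cst.
split => //; apply: cvgM => //; apply: cvgV; first by rewrite gt_eqF.
rewrite -[X in _ --> X]add0r -[X in X + _](mul0r (nu `^ r0)).
apply: cvgD; last exact: cvg_cst.
by apply: cvgM => //; apply: cvg_at_right_filter; exact: cvg_id.
Qed.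

Lemma logdet_div_cvg (r : R -> R) (r0 : R) : r x @[x --> 0^'+] --> r0 ->
  logdet_div ip alpha beta (r alpha) A gam B mu @[alpha --> 0^'+] -->
  beta^-1 * (- (r0 / beta) * ln nu + nu `^ r0 / beta - beta^-1 +
    nu `^ r0 / beta * limn (series (fun j => exp_rem (r0 * t j)))).
Proof.
move=> cr; have [cn cw] := cvg_weight cr; have [M M0 tM] := sq_series_bounded ct.
have c0 : x @[x --> 0^'+] --> (0 : R) by apply: cvg_at_right_filter; exact: cvg_id.
have near_eq : {near 0^'+, (fun alpha => beta^-1 * (- (r alpha / (alpha + beta)) * ln nu +
    ln (1 + alpha * (nu `^ r alpha / beta)) / alpha - ln (1 + alpha * beta^-1) / alpha +
    limn (series (fun j => alpha^-1 *
      log_mix (alpha * weight alpha (r alpha)) (r alpha * t j))))) =1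
    (fun alpha => logdet_div ip alpha beta (r alpha) A gam B mu)}.
  near=> alpha; rewrite logdet_divE//; near: alpha; exact: nbhs_right_gt.
apply: cvg_trans; first exact: near_eq_cvg near_eq.
apply: cvgM; first exact: cvg_cst.
apply: cvgD; last first.
  have -> : nu `^ r0 / beta * limn (series (fun j => exp_rem (r0 * t j))) =
      limn (series (fun j => nu `^ r0 / beta * exp_rem (r0 * t j))).
    apply/esym/(@lim_seriesZ _ (fun j => exp_rem (r0 * t j))).
    have c1 : cvgn (series (fun j => r0 ^+ 2 * expR (`|r0| * M) * t j ^+ 2)).
      exact: is_cvg_seriesZ.
    apply: (le_norm_series_is_cvg _ c1) => j; rewrite ger0_norm ?exp_rem_ge0//.
    exact: exp_rem_mul_le.
  (* Near 0 the weight and |r| exceed the sizes of their limits by at most 1, which makes the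
     majorant independent of alpha. *)
  pose c := (nu `^ r0 / beta + 1) * (`|r0| + 1) ^+ 2 * expR ((`|r0| + 1) * M).
  apply: (@cvg_series_dominated _ _ _ _ (fun j => c * t j ^+ 2)).
  - exact: is_cvg_seriesZ.
  - near=> alpha => j.
    have a0 : 0 < alpha by near: alpha; exact: nbhs_right_gt.
    have [w0 w1] := weight_mix (r alpha) a0.
    apply: le_trans (log_mix_series_le _ _ a0 tM) _.
    apply: ler_wpM2r; first exact: sqr_ge0.
    have rle : `|r alpha| <= `|r0| + 1.
      near: alpha; apply: (cvgr_norm_le r0) => //; lra.
    have wle : weight alpha (r alpha) <= nu `^ r0 / beta + 1.
      near: alpha; apply: (cvgr_le (nu `^ r0 / beta)) => //; lra.
    have w2 : 0 <= weight alpha (r alpha) * r alpha ^+ 2.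
      by apply: mulr_ge0; [exact: ltW|exact: sqr_ge0].
    apply: (ler_pM w2 (expR_ge0 _)); last by rewrite ler_expR; apply: ler_wpM2r.
    apply: (ler_pM (ltW w0) (sqr_ge0 _)) => //.
    rewrite -[r alpha ^+ 2]real_normK ?num_real//.
    by apply: lerXn2r; rewrite ?nnegrE ?addr_ge0.
  - move=> j.
    have cy : r x * t j @[x --> 0^'+] --> r0 * t j by apply: cvgM => //; exact: cvg_cst.
    (* Division by alpha gives the logarithm the form ln (1 + x a(x)) / x with a(x) = weight * (exp
       (r t_j) - 1). *)
    have ce : weight x (r x) * (expR (r x * t j) - 1) @[x --> 0^'+] -->
        nu `^ r0 / beta * (expR (r0 * t j) - 1).
      apply: cvgM => //; apply: cvgB; last exact: cvg_cst.
      by apply: (@continuous_cvg _ _ _ _ _ _ (@expR R)); first exact: continuous_expR.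
    have c1 := ln1_ratio_cvg ce.
    have c2 : weight x (r x) * (r x * t j) @[x --> 0^'+] --> nu `^ r0 / beta * (r0 * t j).
      exact: cvgM.
    rewrite /exp_rem mulrBr.
    have near_eqj : {near 0^'+,
        (fun x => ln (1 + x * (weight x (r x) * (expR (r x * t j) - 1))) / x -
          weight x (r x) * (r x * t j)) =1
        (fun x => x^-1 * log_mix (x * weight x (r x)) (r x * t j))}.
      near=> x; have x0 : 0 < x by near: x; exact: nbhs_right_gt.
      rewrite /log_mix; move: (weight x (r x)) (r x * t j) => w y.
      rewrite -[x * w * (expR y - 1)]mulrA; move: (ln _) => l.
      by field; rewrite gt_eqF.
    apply: cvg_trans; first exact: near_eq_cvg near_eqj.
    exact: cvgB.
apply: cvgB; last by apply: ln1_ratio_cvg; exact: cvg_cst.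
apply: cvgD.
  apply: cvgM; last exact: cvg_cst.
  apply: cvgN; apply: cvgM => //; apply: cvgV; first by rewrite gt_eqF.
  by rewrite -[X in _ --> X]add0r; apply: cvgD => //; exact: cvg_cst.
by apply: ln1_ratio_cvg; apply: cvgM => //; exact: cvg_cst.
Unshelve. all: by end_near. Qed.

End Divergence.

(** * The limit expressed by det_2X *)

(** With C = (B + mu I)^(-1/2) and L the relative operator, (B + mu I)^-1 (A + gam I) = C L C^-1:
    the C e_j are eigenvectors of its power, with eigenvalues nu^s exp (s t_j). *)
Lemma det2X_sim_pow (R : realType) (H : completeNormedModType R)
    (ip : {dot H for idfun}) (norm_ip : forall x : H, `|x| ^+ 2 = ip x x)
    (sepH : separable H) (infH : ~ finite_dim H) (A B : H -> H) (gam mu s : R)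
    (e : nat -> H) (t : nat -> R) :
  PC2 ip A gam -> PC2 ip B mu -> 0 < gam / mu -> onb ip e ->
  (forall k, rel_op ip A gam B mu (e k) = (gam / mu * expR (t k)) *: e k) ->
  cvgn (series (fun k => t k ^+ 2)) ->
  det2X ip (sim_pow ip (op_inv (plusI B mu) \o plusI A gam) s) =
  (gam / mu) `^ s * expR (- limn (series (fun j => exp_rem (s * t j)))).
Proof.
move=> hA hB nu0 eB Le ct; set nu := gam / mu in nu0 Le *.
have hL : PC2 ip (plusI (rel_op ip A gam B mu) (- nu)) nu by exact: rel_op_PC2.
have bB := PC2_bounded hB.
have [f [lam [m [fB Bf [m0 mlam] _ _]]]] := PC2_spectral norm_ip sepH infH hB.
set P := plusI B mu in bB Bf *.
pose C := op_pow ip P (- 2^-1); pose C' := op_pow ip P 2^-1.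
have bC : bounded_op C := op_pow_bounded norm_ip fB bB Bf m0 mlam _.
have bC' : bounded_op C' := op_pow_bounded norm_ip fB bB Bf m0 mlam _.
have CK : cancel C C' by move=> x; exact: (op_powKN norm_ip fB bB Bf m0 mlam).
have C'K : cancel C' C by move=> x; exact: (op_powNK norm_ip fB bB Bf m0 mlam).
have TE : op_inv P \o plusI A gam =
    C \o plusI (plusI (rel_op ip A gam B mu) (- nu)) nu \o C'.
  rewrite plusINK (op_invE norm_ip fB bB Bf m0 mlam); apply/funext => x.
  rewrite /= /rel_op /= -/P -/C C'K.
  have := op_pow_comp norm_ip fB bB Bf m0 mlam (- 2^-1) (- 2^-1).
  have -> : - 2^-1 - 2^-1 = -1 :> R by lra.
  by move=> /(congr1 (@^~ (plusI A gam x))).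
rewrite TE (sim_powE norm_ip sepH infH s bC bC' CK C'K hL).
set L := plusI _ nu.
have LE : L = rel_op ip A gam B mu by rewrite /L plusINK.
have bL : bounded_op (op_pow ip L s) := PC2_op_pow_bounded norm_ip sepH infH s hL.
have Pe j : op_pow ip L s (e j) = (nu `^ s * expR (s * t j)) *: e j.
  rewrite (PC2_op_pow_eigen norm_ip sepH infH (l := nu * expR (t j)) (x := e j) s hL).
  - by rewrite powRM ?ltW ?expR_gt0// -expRM [t j * s]mulrC.
  - by rewrite -/L LE.
  - exact: (onb_neq0 norm_ip eB).
have n0 : 0 < nu `^ s by exact: powR_gt0.
have [M M0 tM] := sq_series_bounded ct.
have nE : - limn (series (fun j => exp_rem (s * t j))) =
    limn (series (fun j => s * t j - (expR (s * t j) - 1))).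
  have c1 : cvgn (series (fun j => exp_rem (s * t j))).
    have c2 : cvgn (series (fun j => s ^+ 2 * expR (`|s| * M) * t j ^+ 2)).
      exact: is_cvg_seriesZ.
    apply: (le_norm_series_is_cvg _ c2) => j; rewrite ger0_norm ?exp_rem_ge0//.
    exact: exp_rem_mul_le.
  rewrite -lim_seriesN//; congr (limn (series _)).
  by apply/funext => j; rewrite /exp_rem fctE opprB.
rewrite nE.
apply: (det2X_conj norm_ip sepH infH bC bC' CK C'K eB) => //.
- by apply: bounded_op_comp => //; exact: bounded_op_comp.
- by move=> j; rewrite /= CK Pe (linear_propZ bC.1).
- have -> : plusI (C \o op_pow ip L s \o C') (- nu `^ s) =
      C \o (plusI (op_pow ip L s) (- nu `^ s) \o C').
    apply/funext => x; rewrite /plusI /= (linear_propD bC.1) (linear_propZ bC.1).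
    by rewrite C'K.
  apply: (hs_compl norm_ip) => //; apply: (hs_compr norm_ip) => //.
  (* From |exp (s t) - 1| <= |s t| exp (|s| M) for |t| <= M. *)
  pose c := (nu `^ s * (`|s| * expR (`|s| * M))) ^+ 2.
  apply: (@hsP _ _ _ _ e (c * limn (series (fun k => t k ^+ 2)))) => //.
    exact: bounded_op_plusI.
  move=> n; apply: (@le_trans _ _ (\sum_(k < n) c * t k ^+ 2)); last first.
    rewrite -mulr_sumr; apply: ler_wpM2l; first exact: sqr_ge0.
    rewrite -(seriesE (fun k => t k ^+ 2)).
    by apply: nneg_series_le_lim ct => k; exact: sqr_ge0.
  apply: ler_sum => k _.
  have -> : plusI (op_pow ip L s) (- nu `^ s) (e k) =
      (nu `^ s * (expR (s * t k) - 1)) *: e k.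
    by rewrite /plusI Pe -scalerDl; congr (_ *: _); ring.
  rewrite normrZ (onb_norm norm_ip eB) mulr1 normrM (gtr0_norm n0).
  rewrite -[t k ^+ 2]real_normK ?num_real// /c -exprMn.
  apply: lerXn2r; rewrite ?nnegrE ?mulr_ge0 ?expR_ge0 ?(ltW n0)//.
  rewrite -mulrA; apply: ler_wpM2l; first exact: ltW.
  apply: le_trans (abs_expR_sub1 _) _.
  rewrite normrM mulrAC; apply: ler_wpM2r => //; apply: ler_wpM2l => //.
  by rewrite ler_expR; apply: ler_wpM2l.
- have c2 : cvgn (series (fun j => s ^+ 2 * expR (`|s| * M) * t j ^+ 2)).
    exact: is_cvg_seriesZ.
  apply: (le_norm_series_is_cvg _ c2) => j.
  have -> : s * t j - (expR (s * t j) - 1) = - exp_rem (s * t j).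
    by rewrite /exp_rem [RHS]opprB.
  by rewrite normr_id normrN ger0_norm ?exp_rem_ge0//; exact: exp_rem_mul_le.
Qed.

Theorem theorem2 (R : realType) (H : completeNormedModType R)
    (ip : {dot H for idfun})
    (norm_ip : forall x : H, `|x| ^+ 2 = ip x x)
    (sepH : separable H) (infH : ~ finite_dim H)
    (A B : H -> H) (gam mu : R)
    (hA : PC2 ip A gam) (hB : PC2 ip B mu)
    (beta : R) (beta_gt0 : 0 < beta)
    (r : R -> R) (r_smooth : smooth_on [set alpha | 0 <= alpha] r)
    (r_neq0 : forall alpha, 0 < alpha -> r alpha != 0) :
  logdet_div ip alpha beta (r alpha) A gam B mu @[alpha --> 0^'+] -->
    (beta ^+ 2)^-1 * ((gam / mu) `^ (r 0) - 1) * (1 + r 0 * ln (gam / mu))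
    - (beta ^+ 2)^-1 * (gam / mu) `^ (r 0) *
      ln (det2X ip (sim_pow ip (op_inv (plusI B mu) \o plusI A gam) (r 0))).
Proof.
have [gam0 _] := PC2_log_spectral norm_ip sepH infH hA.
have [mu0 _] := PC2_log_spectral norm_ip sepH infH hB.
have hL : PC2 ip (plusI (rel_op ip A gam B mu) (- (gam / mu))) (gam / mu).
  exact: rel_op_PC2.
have [nu0 [e [t [eB Le ct]]]] := PC2_log_spectral norm_ip sepH infH hL.
rewrite plusINK in Le.
have cr : r x @[x --> 0^'+] --> r 0.
  (* The smooth extension is continuous at 0 and agrees with [r] on the right of 0. *)
  have [g dg rg] := r_smooth; rewrite rg//=.
  have cg : g x @[x --> 0^'+] --> g 0.
    apply: cvg_at_right_filter; apply: differentiable_continuous.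
    by apply/derivable1_diffP; exact: (dg 0 0).
  have near_rg : {near 0^'+, g =1 r}.
    near=> x; apply/esym/rg => /=; apply: ltW; near: x; exact: nbhs_right_gt.
  by apply: cvg_trans; first exact: near_eq_cvg near_rg.
rewrite (det2X_sim_pow norm_ip sepH infH (r 0) hA hB nu0 eB Le ct).
have n0 : 0 < (gam / mu) `^ r 0 by exact: powR_gt0.
rewrite [ln (_ * expR _)]lnM ?posrE ?expR_gt0// expRK ln_powR.
(* With x = nu^(r 0), l = ln nu and S the sum of remainders, both forms of the limit are beta^-2 (x
   - 1 - r(0) l + x S): the products x r(0) l cancel. *)
rewrite [X in _ --> X](_ : _ = beta^-1 * (- (r 0 / beta) * ln (gam / mu) +
    (gam / mu) `^ r 0 / beta - beta^-1 +
    (gam / mu) `^ r 0 / beta * limn (series (fun j => exp_rem (r 0 * t j))))).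
  exact: (logdet_div_cvg norm_ip sepH infH gam0 mu0 beta_gt0 hL eB Le ct cr).
move: (limn _) (ln _) (_ `^ _) => S l x.
by field; rewrite gt_eqF.
Unshelve. all: by end_near. Qed.
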